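(* Let $d\ge 1$ be an integer, $b$ a prime and $v\ge 0$ an integer. Let $1\leq p<\infty$. There exists a constant $C_{p,d,b,v}>0$ such that for every positive integer $n$ and every order $2$ digital $(v,n,d)$-net $\mathcal{P}_n^b$ over $\mathbb{F}_b$ we have \[ \left\|D_{\mathcal{P}_n^b}\,|\,L_p([0,1)^d)\right\|\leq C_{p,d,b,v}\,\frac{n^{(d-1)/2}}{b^n}. \]
   Context: Discrepancy function: for a finite family $\mathcal{P}$ of $N$ points in $[0,1)^d$ (points counted with multiplicity), $D_{\mathcal{P}}(x)=\frac1N\sum_{z\in\mathcal{P}}\chi_{[0,x)}(z)-x_1\cdots x_d$ for $x=(x_1,\ldots,x_d)\in[0,1)^d$, where $\chi_{[0,x)}$ is the characteristic function of $[0,x)=[0,x_1)\times\cdots\times[0,x_d)$. Digital nets: let $b$ be prime and let $\mathbb{F}_b$ be the field with $b$ elements, identified with $\{0,1,\ldots,b-1\}$ with arithmetic modulo $b$. For $s,n\in\mathbb{N}$ with $s\ge n$ let $C_1,\ldots,C_d$ be $s\times n$ matrices over $\mathbb{F}_b$. For $\nu\in\{0,\ldots,b^n-1\}$ with $b$-adic expansion $\nu=\nu_0+\nu_1b+\cdots+\nu_{n-1}b^{n-1}$ put $\bar\nu=(\nu_0,\ldots,\nu_{n-1})^\top\in\mathbb{F}_b^n$, $C_i\bar\nu=(x_{i,\nu,1},\ldots,x_{i,\nu,s})^\top\in\mathbb{F}_b^s$, $x_{i,\nu}=x_{i,\nu,1}b^{-1}+\cdots+x_{i,\nu,s}b^{-s}\in[0,1)$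 and $x_\nu=(x_{1,\nu},\ldots,x_{d,\nu})$. The family $\mathcal{P}_n^b=\{x_0,\ldots,x_{b^n-1}\}$ of $N=b^n$ points (with multiplicity) is called a digital net over $\mathbb{F}_b$. Order $\sigma$ digital $(v,n,d)$-net: let $\sigma\in\mathbb{N}$, $s\ge\sigma n$, and let $0\le v\le\sigma n$ be an integer. Let $c_{i,1},\ldots,c_{i,s}\in\mathbb{F}_b^n$ be the rows of $C_i$. If for all choices of $0\le\eta_i\le s$ and indices $1\le\lambda_{i,\eta_i}<\cdots<\lambda_{i,1}\le s$ ($1\le i\le d$) with \[\sum_{i=1}^d\left(\lambda_{i,1}+\cdots+\lambda_{i,\min(\eta_i,\sigma)}\right)\le\sigma n-v\] the vectors $c_{1,\lambda_{1,1}},\ldots,c_{1,\lambda_{1,\eta_1}},\ldots,c_{d,\lambda_{d,1}},\ldots,c_{d,\lambda_{d,\eta_d}}$ are linearly independent over $\mathbb{F}_b$, then $\mathcal{P}_n^b$ is called an order $\sigma$ digital $(v,n,d)$-net over $\mathbb{F}_b$. *)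

(* Defs.v *)
From HB Require Import structures.
From mathcomp Require Import all_boot all_order all_algebra.
From mathcomp Require Import all_classical all_reals all_analysis.
Import Order.TTheory GRing.Theory Num.Theory.

Set Implicit Arguments.
Unset Strict Implicit.
Unset Printing Implicit Defensive.

Local Open Scope classical_set_scope.
Local Open Scope ring_scope.

(* Points of R^d are d-tuples, with the library's product sigma-algebra. *)
Notation euclid R d := (d.-tuple (measurableTypeR R)).

Section lebesgue_tuple.
Context {R : realType}.

Definition cons_pair d (x : measurableTypeR R * euclid R d) : euclid R d.+1 :=
  [the d.+1.-tuple (measurableTypeR R) of x.1 :: x.2].

Lemma measurable_cons_pair d : measurable_fun setT (@cons_pair d).
Proof. exact: measurable_cons. Qed.

Definition uncons_pair d (x : euclid R d.+1) : measurableTypeR R * euclid R d :=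
  (thead x, [tuple of behead x]).

Lemma cons_pairK d : cancel (@cons_pair d) (@uncons_pair d).
Proof.
case=> x t; rewrite /uncons_pair /cons_pair /=; congr pair.
by apply: val_inj.
Qed.

Lemma measurable_uncons_pair d : measurable_fun setT (@uncons_pair d).
Proof.
apply/measurable_fun_pairP; split => /=.
- exact: measurable_tnth.
- exact: measurable_behead.
Qed.

Section lebesgue_cons.
Context {d : nat} (m : {sigma_finite_measure set (euclid R d) -> \bar R}).

Definition lebesgue_cons : set (euclid R d.+1) -> \bar R :=
  pushforward (@lebesgue_measure R \x m)%E (@cons_pair d).

Let lebesgue_cons0 : lebesgue_cons set0 = 0%E.
Proof. by rewrite /lebesgue_cons /pushforward preimage_set0 measure0. Qed.

Let lebesgue_cons_ge0 A : (0 <= lebesgue_cons A)%E.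
Proof. by rewrite /lebesgue_cons /pushforward measure_ge0. Qed.

Let lebesgue_cons_sigma_additive : semi_sigma_additive lebesgue_cons.
Proof.
have mcons := @measurable_cons_pair d.
exact: measure_semi_sigma_additive.
Qed.

HB.instance Definition _ := isMeasure.Build _ _ _ lebesgue_cons
  lebesgue_cons0 lebesgue_cons_ge0 lebesgue_cons_sigma_additive.

Let lebesgue_cons_sigma_finite : sigma_finite setT lebesgue_cons.
Proof.
have /sigma_finiteP[F [TF ndF Foo]] := sigma_finiteT (@lebesgue_measure R).
have /sigma_finiteP[G [TG ndG Goo]] := sigma_finiteT m.
exists (fun i => @uncons_pair d @^-1` (F i `*` G i)).
  apply/esym; rewrite -preimage_bigcup -subTset => x _.
  have [i _ Fi] : (\bigcup_i F i) (thead x) by rewrite -TF.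
  have [j _ Gj] : (\bigcup_i G i) [tuple of behead x] by rewrite -TG.
  exists (maxn i j) => //; split.
  - by move: Fi; exact/subsetPset/ndF/leq_maxl.
  - by move: Gj; exact/subsetPset/ndG/leq_maxr.
move=> i; have [mF Fi] := Foo i; have [mG Gi] := Goo i; split.
  rewrite -[X in measurable X]setTI; apply: measurable_uncons_pair => //.
  exact: measurableX.
rewrite /lebesgue_cons /pushforward -comp_preimage.
rewrite (_ : _ \o _ = id); last by apply/funext => x /=; rewrite cons_pairK.
by rewrite /= product_measure1E// lte_mul_pinfty// ge0_fin_numE.
Qed.

HB.instance Definition _ := @Measure_isSigmaFinite.Build _ _ _ lebesgue_cons
  lebesgue_cons_sigma_finite.

End lebesgue_cons.

(* The d-dimensional Lebesgue measure, as an iterated product measure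
   (R^0 is a single point of mass 1); see lebesgue_tuple_box. *)
Fixpoint lebesgue_tuple (d : nat) :
    {sigma_finite_measure set (euclid R d) -> \bar R} :=
  if d is d'.+1 then lebesgue_cons (lebesgue_tuple d')
  else @dirac _ (euclid R 0) [tuple] R.

Lemma lebesgue_tuple_box d (A : 'I_d -> set (measurableTypeR R)) :
  (forall i, measurable (A i)) ->
  lebesgue_tuple d [set x | forall i, A i (tnth x i)]
  = (\prod_(i < d) lebesgue_measure (A i))%E.
Proof.
elim: d => [|d IH] in A * => mA.
  rewrite big_ord0 /= diracE mem_set//= => -[]//.
rewrite big_ord_recl /= /lebesgue_cons /pushforward.
set B := [set t : euclid R d | forall i, A (lift ord0 i) (tnth t i)].
rewrite (_ : _ @^-1` _ = A ord0 `*` B); last first.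
  apply/seteqP; split=> -[x t].
    by move=> H; split=> [|i]; [exact: (H ord0)|have := H (lift ord0 i); rewrite tnthS].
  move=> [A0 H] i; have [j ->|->//] := unliftP ord0 i.
  by rewrite tnthS; exact: H.
rewrite product_measure1E//; first by rewrite -IH.
rewrite (_ : B = \bigcap_(i in [set: 'I_d]) (@tnth _ _ ^~ i @^-1` A (lift ord0 i))).
  apply: fin_bigcap_measurable => // i _.
  by rewrite -[X in measurable X]setTI; exact: measurable_tnth.
by apply/seteqP; split => [t Bt i _|t H i]; [exact: Bt|exact: H].
Qed.

End lebesgue_tuple.
Arguments lebesgue_tuple R d : clear implicits.

Section discrepancy.
Context {R : realType} {d : nat}.

Definition unit_cube : set (euclid R d) :=
  [set x | forall i, tnth x i \in `[0, 1[].

Definition anchored_box (x : euclid R d) : set (euclid R d) :=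
  [set z | forall i, tnth z i \in `[0, tnth x i[].

Definition discrepancy (N : nat) (P : 'I_N -> euclid R d) (x : euclid R d) : R :=
  N%:R^-1 * \sum_(k < N) \1_(anchored_box x) (P k) - \prod_(i < d) tnth x i.

(* The norm of L_p([0,1)^d): f is extended by zero outside the cube. *)
Definition Lp_cube (p : R) (f : euclid R d -> R) : \bar R :=
  Lnorm (lebesgue_tuple R d) p%:E ((EFin \o f) \_ unit_cube).

Lemma Lp_cubeE (p : R) (f : euclid R d -> R) : p != 0 ->
  Lp_cube p f = ((\int[lebesgue_tuple R d]_(x in unit_cube)
                   (`|f x| `^ p)%:E) `^ p^-1)%E.
Proof.
move=> p0; rewrite /Lp_cube unlock [in RHS]integral_mkcond.
congr poweR.
apply: eq_integral => x _; rewrite !patchE; case: ifPn => //= _.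
by rewrite normr0 powR0.
Qed.

End discrepancy.

Section digital_net.
Context {R : realType} {b : nat} {d s n : nat}.

Definition digits (nu : nat) : 'cV['F_b]_n :=
  \col_(j < n) ((nu %/ b ^ j) %% b)%:R.

Definition radix_value (y : 'cV['F_b]_s) : R :=
  \sum_(k < s) (y k ord0 : nat)%:R / b%:R ^+ k.+1.

Definition digital_net (C : 'I_d -> 'M['F_b]_(s, n)) (nu : 'I_(b ^ n)) :
    euclid R d :=
  [tuple radix_value (C i *m digits nu) | i < d].

(* For each i, lam i lists lambda_(i,1) > ... > lambda_(i,eta_i), where
   l : 'I_s stands for the index l.+1.  The rows are listed with repetitions,
   so independence is that of the family. *)
Definition order_independent (sigma v : nat) (C : 'I_d -> 'M['F_b]_(s, n)) :=
  forall lam : 'I_d -> seq 'I_s,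
    (forall i, sorted (fun l l' : 'I_s => (l' < l)%N) (lam i)) ->
    (\sum_(i < d) \sum_(l <- take sigma (lam i)) l.+1 <= sigma * n - v)%N ->
    free [seq row l (C i) | i <- enum 'I_d, l <- lam i].

End digital_net.

Definition order_digital_net {R : realType} (b sigma v n d : nat)
    (P : 'I_(b ^ n) -> euclid R d) : Prop :=
  exists (s : nat) (C : 'I_d -> 'M['F_b]_(s, n)),
    [/\ (0 < sigma)%N, (sigma * n <= s)%N, (v <= sigma * n)%N,
        order_independent sigma v C & P = digital_net C].

(* Main.v *)
Require Import Defs.
From HB Require Import structures.
From mathcomp Require Import all_boot all_order all_algebra.
From mathcomp Require Import all_classical all_reals all_analysis.
From mathcomp Require Import measurable_realfun.
From mathcomp Require Import ring lra zify.

(* Truncating the points of the net to n digits per coordinate changes the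
   discrepancy by O(b^-n), so it suffices to bound even moments of a function D
   of digit matrices K (the cells of side b^-n).  In each coordinate the
   indicator 1[z <= K] is a sum of martingale differences in the digits of K
   (the b-adic Haar levels), which writes D as a sum over levels j in {0..n}^d.
   An elementary martingale inequality (power type 2 in L_2k), applied in one
   coordinate at a time, bounds the 2k-th moment of D by that of the l_2 sum of
   its components, so it remains to see that the component of level j has
   2k-norm at most C b^-n rho^||j|-n| with rho < 1: the number of j with |j|
   near n is O(n^(d-1)).
   - For |j| <= n, expand the factors in the remaining digits of the points.
     A term using the first j_i digits and the digit p_i of coordinate i has
     zero error when sum (j_i + p_i) <= 2n - v, by order 2; the surviving terms
     carry weights b^-sum(p_i - j_i) and a box of volume b^-|j|.
   - For |j| >= n, the component is bounded by the share of the net in a box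
     of volume b^-|j|, which is O(b^-n) pointwise and O(b^-|j|) on average. *)

Set Implicit Arguments.
Unset Strict Implicit.
Unset Printing Implicit Defensive.
Import Order.TTheory GRing.Theory Num.Theory.
Local Open Scope ring_scope.

(** * Averages and the martingale moment inequality *)

Section averages.
Context {R : realFieldType} {T : finType}.
Implicit Types f g x y : T -> R.

Definition avg f : R := (\sum_t f t) / #|T|%:R.

Lemma eq_avg f g : f =1 g -> avg f = avg g.
Proof. by move=> fg; congr (_ / _); apply: eq_bigr => t _; exact: fg. Qed.

Lemma avgD f g : avg (fun t => f t + g t) = avg f + avg g.
Proof. by rewrite /avg big_split mulrDl. Qed.

Lemma avgZ c f : avg (fun t => c * f t) = c * avg f.
Proof. by rewrite /avg -mulr_sumr mulrA. Qed.

Lemma avg_sum (I : finType) (P : pred I) (F : I -> T -> R) :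
  avg (fun t => \sum_(i | P i) F i t) = \sum_(i | P i) avg (F i).
Proof. by rewrite /avg exchange_big mulr_suml. Qed.

Lemma ler_avg f g : (forall t, f t <= g t) -> avg f <= avg g.
Proof. by move=> fg; rewrite ler_wpM2r ?invr_ge0// ler_sum. Qed.

Lemma avg_ge0 f : (forall t, 0 <= f t) -> 0 <= avg f.
Proof. by move=> f0; rewrite divr_ge0// sumr_ge0. Qed.

Lemma ler_norm_avg f : `|avg f| <= avg (fun t => `|f t|).
Proof.
by rewrite /avg normrM normfV normr_nat ler_wpM2r ?invr_ge0// ler_norm_sum.
Qed.

Lemma avg_cst c : (0 < #|T|)%N -> avg (fun=> c) = c.
Proof.
move=> T0; rewrite /avg sumr_const -[c *+ _]mulr_natr mulfK//.
by rewrite pnatr_eq0 -lt0n.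
Qed.

Lemma avg_reindex f (h : T -> T) : injective h -> avg (f \o h) = avg f.
Proof. by move=> h_inj; rewrite /avg [in RHS](reindex_inj h_inj). Qed.

End averages.

Lemma avg_exchange (R : realFieldType) (S T : finType) (F : S -> T -> R) :
  avg (fun s => avg (F s)) = avg (fun t => avg (F^~ t)).
Proof.
rewrite /avg -!mulr_suml exchange_big /= -!mulrA; congr (_ * _).
exact: mulrC.
Qed.

(** * The power type 2 inequality for even moments *)

Section moments.
Context {R : realFieldType}.
Implicit Types (a b x y S s : R) (k : nat).

Lemma mulXn_le_max a b k l : 0 <= a -> 0 <= b ->
  a ^+ k * b ^+ l <= a ^+ (k + l) + b ^+ (k + l).
Proof.
move=> a0 b0; have [ab|/ltW ba] := leP a b.
- rewrite (le_trans (y := b ^+ (k + l)))// ?lerDr ?exprn_ge0//.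
  by rewrite exprD ler_wpM2r ?exprn_ge0// lerXn2r ?nnegrE.
- rewrite (le_trans (y := a ^+ (k + l)))// ?lerDl ?exprn_ge0//.
  by rewrite exprD ler_wpM2l ?exprn_ge0// lerXn2r ?nnegrE.
Qed.

Lemma exprn_double x k : x ^+ k.*2 = (x ^+ 2) ^+ k.
Proof. by rewrite -exprM mul2n. Qed.

(** Every binomial term with at least two factors [y] is at most its coefficient times
    [(|x| ^+ k.*2 + |y| ^+ k.*2) * y ^+ 2], and these coefficients add up to at most
    [2 ^+ k.+1.*2]. *)
Lemma exprD_even_le x y k :
  (x + y) ^+ k.+1.*2 <= x ^+ k.+1.*2 + k.+1.*2%:R * (x ^+ k.*2.+1 * y)
     + 2 ^+ k.+1.*2 * ((x ^+ 2) ^+ k * y ^+ 2 + (y ^+ 2) ^+ k.+1).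
Proof.
set Q := (X in 2 ^+ _ * X).
have Q0 : 0 <= Q.
  have x2 := sqr_ge0 x; have y2 := sqr_ge0 y.
  exact: (addr_ge0 (mulr_ge0 (exprn_ge0 _ x2) y2) (exprn_ge0 _ y2)).
rewrite [2 in leRHS](_ : _ = 1 + 1 :> R)// !doubleS !exprDn 2!big_ord_recl /=.
rewrite !subn0 expr0 mulr1 bin0 mulr1n expr1 bin1 subn1 /= mulr_natl addrA lerD2l.
rewrite [in leRHS]big_ord_recl [X in _ <= (_ + X) * _]big_ord_recl /=.
rewrite !mulrDl addrA -[leLHS]add0r lerD//.
  by rewrite addr_ge0// mulr_ge0// mulrn_wge0// mulr_ge0// exprn_ge0.
rewrite mulr_suml ler_sum// => i _; rewrite !expr1n mulr1 mulr_natl lerMn2r.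
apply/orP; right; have -> : bump 0 (bump 0 i) = i.+2 by [].
rewrite !subSS (le_trans (ler_norm _))// normrM !normrX /Q.
rewrite -(real_normK (num_real x)) -(real_normK (num_real y)) [_ ^+ k.+1]exprSr.
rewrite -mulrDl -[i.+2]addn2 exprD mulrA.
rewrite mulrC [leRHS]mulrC ler_wpM2l ?exprn_ge0// -!exprM !mul2n.
have := @mulXn_le_max `|x| `|y| (k.*2 - i) i.
by rewrite subnK; [apply|rewrite -ltnS].
Qed.

(* In the binomial expansion only the term linear in [y] cannot be absorbed by
   [S ^+ k * s] and [s ^+ k.+1], and it vanishes by orthogonality. *)
Lemma avg_moment_step (T : finType) (x y : T -> R) S s k :
  0 < S -> 0 < s -> \sum_t x t ^+ k.*2.+1 * y t = 0 ->
  avg (fun t => x t ^+ k.+1.*2) <= S ^+ k.+1 ->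
  avg (fun t => y t ^+ k.+1.*2) <= s ^+ k.+1 ->
  avg (fun t => (x t + y t) ^+ k.+1.*2) <= (S + 2 ^+ k.*2.+4 * s) ^+ k.+1.
Proof.
move=> S0 s0 xy0 xS ys; set A : R := 2 ^+ k.+1.*2.
have A1 : 1 <= A by rewrite exprn_ege1// ler1n.
have Sk0 : S ^+ k.+1 != 0 by rewrite expf_neq0// gt_eqF.
have sk0 : s ^+ k.+1 != 0 by rewrite expf_neq0// gt_eqF.
pose B := S ^+ k * s.
have B0 : 0 <= B := mulr_ge0 (exprn_ge0 k (ltW S0)) (ltW s0).
(* A crude Young inequality is applied to [x ^+ 2 / S] and [y ^+ 2 / s], whose moments of order
   [k.+1] are at most 1, and scaled back by [B]. *)
have xy_le t : (x t ^+ 2) ^+ k * y t ^+ 2 <=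
    (B / S ^+ k.+1) * x t ^+ k.+1.*2 + (B / s ^+ k.+1) * y t ^+ k.+1.*2.
  have := mulXn_le_max k 1 (divr_ge0 (sqr_ge0 (x t)) (ltW S0))
                           (divr_ge0 (sqr_ge0 (y t)) (ltW s0)).
  rewrite addn1 => /(ler_wpM2l B0).
  rewrite mulrDr !expr_div_n !exprn_double !expr1.
  congr (_ <= _); first by rewrite /B; field; rewrite !gt_eqF// exprn_gt0.
  by congr (_ + _); ring.
have mix : avg (fun t => (x t ^+ 2) ^+ k * y t ^+ 2) <= 2 * B.
  apply: le_trans (ler_avg xy_le) _; rewrite avgD !avgZ mulrDl mul1r lerD//.
  - rewrite -[leRHS]mulr1 -[in leRHS](mulVf Sk0) [in leRHS]mulrA.
    by rewrite ler_wpM2l// divr_ge0// exprn_ge0// ltW.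
  - rewrite -[leRHS]mulr1 -[in leRHS](mulVf sk0) [in leRHS]mulrA.
    by rewrite ler_wpM2l// divr_ge0// exprn_ge0// ltW.
apply: le_trans (ler_avg (fun t => exprD_even_le (x t) (y t) k)) _.
rewrite !avgD !avgZ avgD.
have -> : avg (fun t => x t ^+ k.*2.+1 * y t) = 0 by rewrite /avg xy0 mul0r.
rewrite mulr0 addr0; pose u := 2 * A * s.
have A0 : 0 <= A := le_trans ler01 A1.
have u0 : 0 <= u := mulr_ge0 (mulr_ge0 (ler0n _ 2) A0) (ltW s0).
have -> : 2 ^+ k.*2.+4 * s = u + u.
  by rewrite /u /A doubleS !exprS; ring.
apply: (@le_trans _ _ (S ^+ k.+1 + A * (2 * B + s ^+ k.+1))).
  rewrite lerD// ler_wpM2l ?exprn_ge0// lerD//.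
  by under eq_avg do rewrite -exprn_double.
have Sge0 := ltW S0; have sge0 := ltW s0.
have Su : S <= S + (u + u) by rewrite lerDl addr_ge0.
have uS : u <= S + (u + u) by rewrite addrCA lerDl addr_ge0.
have S1 : 0 <= S + (u + u) := le_trans Sge0 Su.
have SX j : S ^+ j <= (S + (u + u)) ^+ j by rewrite lerXn2r.
have uX j : u ^+ j <= (S + (u + u)) ^+ j by rewrite lerXn2r.
rewrite [leRHS]exprS [leRHS]mulrDl lerD//; first by rewrite exprS ler_wpM2l.
rewrite mulrDr [leRHS]mulrDl lerD//.
  have -> : A * (2 * B) = u * S ^+ k by rewrite /u /B; ring.
  by rewrite ler_wpM2l.
apply: (@le_trans _ _ (u ^+ k.+1)); last by rewrite exprS ler_wpM2l.
rewrite /u exprMn ler_wpM2r ?exprn_ge0//.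
have A2 : A <= 2 * A by rewrite ler_peMl// ler1n.
by rewrite (le_trans A2)// ler_eXnr// (le_trans A1).
Qed.

(** The constant multiplies only the newly added [s j], so iterating the two-term inequality does
    not compound it. The orthogonality hypothesis is the martingale property, tested against odd
    powers of the partial sums. *)
Lemma avg_moment_sum (T : finType) (g : nat -> T -> R) (s : nat -> R) k m :
  (forall j, (j <= m)%N -> 0 < s j) ->
  (forall j, (j < m)%N ->
    \sum_t (\sum_(i < j.+1) g i t) ^+ k.*2.+1 * g j.+1 t = 0) ->
  (forall j, (j <= m)%N -> avg (fun t => g j t ^+ k.+1.*2) <= s j ^+ k.+1) ->
  avg (fun t => (\sum_(j < m.+1) g j t) ^+ k.+1.*2) <=
    (2 ^+ k.*2.+4 * \sum_(j < m.+1) s j) ^+ k.+1.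
Proof.
have c1 : 1 <= 2 ^+ k.*2.+4 :> R by rewrite exprn_ege1// ler1n.
move: c1 (fun (x y : T -> R) S s => @avg_moment_step T x y S s k).
move: (2 ^+ k.*2.+4) => c c1 step; have c0 : 0 < c := lt_le_trans ltr01 c1.
elim: m => [|m IH] s0 orth gs.
  under eq_avg do rewrite big_ord1; rewrite big_ord1.
  have s00 := ltW (s0 0%N (leqnn _)); rewrite (le_trans (gs 0%N _))//.
  by rewrite lerXn2r ?nnegrE ?ler_peMl// mulr_ge0// ltW.
under eq_avg do rewrite big_ord_recr /=; rewrite big_ord_recr /= mulrDr.
apply: step; [|exact: s0|exact: orth| |exact: gs].
- rewrite mulr_gt0// big_ord_recl ltr_pwDl ?s0// sumr_ge0// => i _.
  by rewrite ltW ?s0// (leq_trans _ (leqnSn _)) ?ltn_ord.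
- by apply: IH => j jm; [exact/s0/leqW|exact/orth/leqW|exact/gs/leqW].
Qed.

End moments.

Lemma avg_prod (R : realFieldType) (I T : finType) (F : I -> T -> R) :
  avg (fun w : {ffun I -> T} => \prod_i F i (w i)) = \prod_i avg (F i).
Proof.
rewrite /avg prodf_div bigA_distr_bigA /= card_ffun; congr (_ / _).
by rewrite prodr_const natrX.
Qed.

(** * Digit expansions of the one-dimensional indicator *)

Section digit_rows.
Context {b n : nat} (b_pr : prime b).
Notation digit_row := {ffun 'I_n -> 'F_b}.
Implicit Types (z K : digit_row) (a : 'I_n) (j J : nat).

Lemma Fp_lt (t : 'F_b) : (t < b)%N.
Proof. by rewrite -{2}(Fp_cast b_pr). Qed.

Lemma card_digit_row : #|{: digit_row}| = (b ^ n)%N.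
Proof. by rewrite card_ffun card_Fp// card_ord. Qed.

(** For [J <= n]: both rows lie in the same b-adic interval of length b^-J. *)
Definition agree J z K := [forall a : 'I_n, (a < J)%N ==> (z a == K a)].

Lemma agree0 z K : agree 0 z K.
Proof. exact/forallP. Qed.

Lemma agreeS a z K : agree a.+1 z K = agree a z K && (z a == K a).
Proof.
apply/forallP/andP => [H|[/forallP H Ka] a'].
  split; last by have := H a; rewrite ltnSn.
  by apply/forallP => a'; apply/implyP => a'a; apply: (implyP (H a')); exact: leqW.
rewrite ltnS leq_eqVlt; apply/implyP => /orP[/eqP/val_inj->//|].
exact/implyP.
Qed.

Lemma agreeC J z K : agree J z K = agree J K z.
Proof. by apply: eq_forallb => a; rewrite eq_sym. Qed.

Lemma eq_agree J z z' K : (forall a, (a < J)%N -> z a = z' a) ->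
  agree J z K = agree J z' K.
Proof.
move=> zz'; apply: eq_forallb => a; have [aJ|//] := boolP (a < J)%N.
by rewrite zz'.
Qed.

Lemma eq_agreer J z K K' : (forall a, (a < J)%N -> K a = K' a) ->
  agree J z K = agree J z K'.
Proof. by move=> KK'; rewrite !(agreeC J z); exact: eq_agree. Qed.

Lemma agree_le J j z K : (J <= j)%N -> agree j z K -> agree J z K.
Proof.
move=> Jj /forallP H; apply/forallP => a; apply/implyP => aJ.
by apply: (implyP (H a)); exact: leq_trans Jj.
Qed.

(** For [J <= n], the first [J] digits read as an integer, digit 0 being the most significant. *)
Definition prefix_val J z : nat := \sum_(a < n | (a < J)%N) z a * b ^ (J - a.+1).

Lemma prefix_val0 z : prefix_val 0 z = 0%N.
Proof. by rewrite /prefix_val big_pred0. Qed.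

Lemma prefix_valS a z : prefix_val a.+1 z = (prefix_val a z * b + z a)%N.
Proof.
rewrite /prefix_val (bigD1 a)//= subnn muln1 addnC; congr addn.
rewrite big_distrl /=; apply: eq_big => [a'|a' /andP[]].
  by rewrite ltnS [RHS]ltn_neqAle andbC -val_eqE.
rewrite ltnS => a'a; rewrite -val_eqE /= => ne.
by rewrite -mulnA -expnSr subSn// ltn_neqAle ne.
Qed.

(** The step receives its index as an ordinal, so that it can serve as a digit position. *)
Lemma ordinal_ind_le (P : nat -> Prop) :
  P 0%N -> (forall a : 'I_n, P a -> P a.+1) -> forall J, (J <= n)%N -> P J.
Proof.
move=> P0 PS; elim=> // J IH Jn.
by apply: (PS (Ordinal Jn)); apply: IH; exact: ltnW.
Qed.

Lemma prefix_val_lt J z : (J <= n)%N -> (prefix_val J z < b ^ J)%N.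
Proof.
move: J; apply: ordinal_ind_le => [|a IH]; first by rewrite prefix_val0.
by have := Fp_lt (z a); rewrite prefix_valS expnSr; move: IH; nia.
Qed.

Lemma agree_prefix_val J z K : (J <= n)%N ->
  agree J z K = (prefix_val J z == prefix_val J K).
Proof.
move: J; apply: ordinal_ind_le => [|a IH]; first by rewrite !prefix_val0 agree0 eqxx.
rewrite agreeS IH !prefix_valS -val_eqE /=.
have := Fp_lt (z a); have := Fp_lt (K a).
move: (prefix_val a z) (prefix_val a K) (z a : nat) (K a : nat) => p q u w wb ub.
apply/andP/eqP => [[/eqP-> /eqP->]//|E].
have pq : p = q by have [pq|qp|] := ltngtP p q => //; nia.
by rewrite pq eqxx; split=> //; apply/eqP; lia.
Qed.

Lemma prefix_val_inj : injective (prefix_val n).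
Proof.
move=> z K /eqP; rewrite -agree_prefix_val// => /forallP zK.
by apply/ffunP => a; have := zK a; rewrite ltn_ord => /eqP.
Qed.

Definition val_ord z : 'I_(b ^ n) := Ordinal (prefix_val_lt z (leqnn n)).

Lemma val_ord_bij : bijective val_ord.
Proof.
apply: inj_card_bij; last by rewrite card_ord card_digit_row.
by move=> z K /(congr1 val) /=; exact: prefix_val_inj.
Qed.

End digit_rows.

(** * Martingale differences of the indicator and their expansion in digits *)

Section increments.
Context {R : realFieldType} {b n : nat} (b_pr : prime b).
Notation digit_row := {ffun 'I_n -> 'F_b}.
Implicit Types (z K : digit_row) (a : 'I_n) (j J : nat).

Let b_gt0 : (0 < b)%N := prime_gt0 b_pr.
Let bR_gt0 : 0 < b%:R :> R. Proof. by rewrite ltr0n. Qed.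
Let bR_neq0 : b%:R != 0 :> R. Proof. by rewrite gt_eqF. Qed.

Lemma avg_agree J K : (J <= n)%N ->
  avg (fun z => (agree J z K)%:R) = b%:R ^- J :> R.
Proof.
move=> Jn; pose F a (t : 'F_b) : R := ((a < J)%N ==> (t == K a))%:R.
rewrite (eq_avg (g := fun z => \prod_a F a (z a))); last first.
  move=> z; rewrite /F; have [/forallP H|] := boolP (agree J z K).
    by rewrite big1// => a _; rewrite H.
  by rewrite negb_forall => /existsP[a Ha]; rewrite (bigD1 a)//= (negbTE Ha) mul0r.
rewrite avg_prod -exprVn; transitivity (\prod_(a < n) (if (a < J)%N then b%:R^-1 else 1 : R)).
  apply: eq_bigr => a _; rewrite /F; case: ifP => aJ; last first.
    by rewrite (eq_avg (g := fun=> 1))// avg_cst// card_Fp.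
  rewrite /avg card_Fp// (bigD1 (K a))//= eqxx big1 ?addr0 ?div1r// => t.
  by move=> /negbTE ->.
rewrite -big_mkcond -(big_ord_widen n (fun=> b%:R^-1) Jn).
by rewrite prodr_const card_ord.
Qed.

(** At most one term is nonzero, that of the first digit where the rows differ: lexicographic and
    numerical order coincide. *)
Lemma sum_lex_prefix_val J z K : (J <= n)%N ->
  \sum_(a < n | (a < J)%N) (agree a z K && (z a < K a)%N)%:R
  = (prefix_val J z < prefix_val J K)%:R :> R.
Proof.
move: J; apply: ordinal_ind_le => [|a IH]; first by rewrite big_pred0// !prefix_val0.
rewrite (bigD1 a)//= addrC; under eq_bigl => a'.
  rewrite ltnS -val_eqE /= andbC -ltn_neqAle; over.
rewrite IH agree_prefix_val ?(ltnW (ltn_ord a))// !prefix_valS.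
have := Fp_lt b_pr (z a); have := Fp_lt b_pr (K a).
move: (prefix_val a z) (prefix_val a K) (z a : nat) (K a : nat) => p q u w wb ub.
rewrite -natrD; congr (_%:R)%R.
have [pq|qp|<-] := ltngtP p q; rewrite /= ?addn0 ?add0n.
- by symmetry; apply/eqP; rewrite eqb1; nia.
- by symmetry; apply/eqP; rewrite eqb0; nia.
- by rewrite ltn_add2l.
Qed.

Section offset.
Context (eps : bool).

(* [eps] selects the convention at the boundary: [level n z K] is the indicator
   of [z <= K] if [eps = false] and of [z < K] if [eps = true] ([levelnE]), and
   [level J z K] is its average over the digits of [K] of index at least [J]. *)
Definition digit_tail J z : R :=
  \sum_(a < n | (J <= a)%N) (z a : nat)%:R / b%:R ^+ (a.+1 - J)
  + eps%:R / b%:R ^+ (n - J).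

Definition level J z K : R :=
  \sum_(a < n | (a < J)%N) (agree a z K && (z a < K a)%N)%:R
  + (agree J z K)%:R * (1 - digit_tail J z).

(** Martingale differences in the digits of [K]; index 0 holds the mean, so that the differences up
    to [J] sum to [level J]. *)
Definition increment j z K : R :=
  if j is J.+1 then level J.+1 z K - level J z K else level 0 z K.

Lemma sum_increment J z K : \sum_(j < J.+1) increment j z K = level J z K.
Proof.
by elim: J => [|J IH]; rewrite ?big_ord1// big_ord_recr /= IH addrC subrK.
Qed.

Lemma levelnE z K :
  level n z K = (prefix_val n z < prefix_val n K + ~~ eps)%:R.
Proof.
rewrite /level sum_lex_prefix_val// agree_prefix_val// /digit_tail.
rewrite big_pred0 => [|a]; last by rewrite leqNgt ltn_ord.
rewrite add0r subnn expr0 divr1.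
move: (prefix_val n z) (prefix_val n K) => p q.
by have [pq|qp|<-] := ltngtP p q; case: eps; rewrite /= ?subrr ?subr0 ?mulr0 ?mul0r
  ?mulr1 ?addr0 ?add0r ?addn0 ?addn1 ?ltnn ?ltnS ?leqnn//
  ?pq ?(ltnW pq)// ?(leqNgt p q) ?(ltnNge p q) ?qp ?(ltnW qp).
Qed.

Lemma avg_leveln K :
  avg (fun z => level n z K) = (prefix_val n K + ~~ eps)%:R / b%:R ^+ n.
Proof.
rewrite /avg card_digit_row// natrX; congr (_ / _).
under eq_bigr do rewrite levelnE.
set m := (prefix_val n K + _)%N.
have mb : (m <= b ^ n)%N.
  by have := prefix_val_lt b_pr K (leqnn n); rewrite /m; case: eps => /=; lia.
have [g gK Kg] := @val_ord_bij b n b_pr.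
rewrite (reindex g) /=; last by exists (val_ord b_pr) => x _; [exact: Kg|exact: gK].
under eq_bigr => k _.
  rewrite (_ : prefix_val n (g k) = k); last by rewrite -{2}(Kg k).
  over.
rewrite -natr_sum; congr (_%:R)%R.
rewrite -big_mkcond -(big_ord_widen _ (fun=> 1%N) mb).
by rewrite sum1_card card_ord.
Qed.

Lemma digit_tailS a z :
  digit_tail a z = ((z a : nat)%:R + digit_tail a.+1 z) / b%:R.
Proof.
rewrite /digit_tail (bigD1 a)//= subSnn expr1 !mulrDl -!addrA; congr (_ + _).
congr (_ + _); last by rewrite -mulrA -invfM -exprSr subnSK.
rewrite mulr_suml; apply: eq_big => [a'|a' /andP[aa' ne]].
  by rewrite [RHS]ltn_neqAle eq_sym andbC.
by rewrite -mulrA -invfM -exprSr subSn// ltn_neqAle eq_sym -val_eqE in ne *; rewrite ne.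
Qed.

(** Once the first [a] digits agree, only the comparison of digit [a] is new; a tie is replaced by
    the expected outcome of the remaining digits. *)
Lemma incrementS a z K : increment a.+1 z K = (agree a z K)%:R *
  ((z a < K a)%N%:R + (z a == K a)%:R * (1 - digit_tail a.+1 z)
   - (1 - digit_tail a z)).
Proof.
rewrite /increment /level (bigD1 a)//=; under eq_bigl => a'.
  rewrite ltnS -val_eqE /= andbC -ltn_neqAle; over.
by rewrite agreeS -!mulnb !natrM; ring.
Qed.

Lemma digit_tail_bounds j z : (j <= n)%N -> 0 <= digit_tail j z <= 1.
Proof.
(* Downward induction on [j]: at [j = n] the tail is [eps], and each step down adds a digit and
   divides by [b]. *)
move=> jn; rewrite -(subKn jn); elim: (n - j)%N (leq_subr j n) => [|m IH] mn.
  rewrite subn0 /digit_tail big_pred0 => [|a]; last by rewrite leqNgt ltn_ord.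
  by rewrite add0r subnn expr0 divr1; case: eps; rewrite lexx ler01.
have an : (n - m.+1 < n)%N by rewrite ltn_subrL (leq_trans _ mn).
rewrite (digit_tailS (Ordinal an)) /= -subSn// subSS.
have /andP[t0 t1] := IH (ltnW mn).
apply/andP; split; first by apply: divr_ge0 => //; exact: addr_ge0.
rewrite ler_pdivrMr// mul1r.
rewrite (le_trans (y := (z (Ordinal an)).+1%:R)) ?ler_nat ?Fp_lt//.
by rewrite -natr1 lerD2l.
Qed.

Lemma increment_bound j z K : (j <= n)%N ->
  `|increment j z K| <= 2 * (agree j.-1 z K)%:R.
Proof.
case: j => [|j] jn.
  rewrite /increment /level big_pred0// add0r agree0 mul1r mulr1.
  by have := @digit_tail_bounds 0 z isT; rewrite ler_norml; lra.
rewrite (incrementS (Ordinal jn)) normrM normr_nat mulrC ler_wpM2r//.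
have /andP[s0 s1] := digit_tail_bounds z jn.
have /andP[t0 t1] := digit_tail_bounds z (ltnW jn).
rewrite ler_norml; move: s0 s1 t0 t1 => /=.
by case: (_ < _)%N; case: (_ == _); rewrite /= ?mul1r ?mul0r => *; lra.
Qed.

(** Adding [unit_row a t] for all [t] runs through all values of digit [a]; averaging over [t] plays
    the role of a conditional expectation. *)
Definition unit_row a (t : 'F_b) : digit_row := [ffun a' => if a' == a then t else 0].

Lemma add_unit_row_neq K a t a' : a' != a -> (K + unit_row a t) a' = K a'.
Proof. by move=> /negbTE ne; rewrite !ffunE ne addr0. Qed.

Lemma eq_level J z K K' : (forall a, (a < J)%N -> K a = K' a) ->
  level J z K = level J z K'.
Proof.
move=> KK'; rewrite /level; congr (_ + _%:R * _); last first.
  by rewrite (eq_agreer _ KK').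
apply: eq_bigr => a aJ; rewrite KK'// (@eq_agreer _ _ _ _ K K')// => a' a'a.
by rewrite KK'// (ltn_trans a'a).
Qed.

(** Adaptedness: [increment j] is determined by the digits of [K] of index below [j]. *)
Lemma increment_shift j z K a t : (j <= a)%N ->
  increment j z (K + unit_row a t) = increment j z K.
Proof.
have lev J : (J <= a)%N -> level J z (K + unit_row a t) = level J z K.
  move=> Ja; apply: eq_level => a' a'J; rewrite add_unit_row_neq// -val_eqE /=.
  by rewrite neq_ltn (leq_trans a'J).
by case: j => [|j] ja; rewrite /= !lev// ltnW.
Qed.

Lemma sum_Fp_gt (u : 'F_b) : \sum_(t : 'F_b) (u < t)%N%:R = b%:R - 1 - (u : nat)%:R :> R.
Proof.
have sum_gt (w m : nat) : (\sum_(t < m) (w < t)%N = m - w.+1)%N.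
  elim: m => [|m IH]; first by rewrite big_ord0.
  by rewrite big_ord_recr /= IH; case: (ltnP w m) => um /=; lia.
rewrite -natr_sum sum_gt; have := Fp_lt b_pr u; move: (u : nat) => w wb.
by rewrite Fp_cast// natrB// -natr1; ring.
Qed.

(** The martingale property: among the [b] values of the digit, [b - 1 - z a] exceed [z a] and one
    ties, which matches [b] times the mean [1 - digit_tail a z]. *)
Lemma sum_increment_shift a z K : \sum_t increment a.+1 z (K + unit_row a t) = 0.
Proof.
pose F (u : 'F_b) : R := (z a < u)%N%:R + (z a == u)%:R * (1 - digit_tail a.+1 z)
   - (1 - digit_tail a z).
transitivity (\sum_t (agree a z K)%:R * F (K a + t)).
  apply: eq_bigr => t _; rewrite incrementS; congr ((nat_of_bool _)%:R * _).
    apply: eq_agreer => a' a'a.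
    by rewrite add_unit_row_neq// -val_eqE /= neq_ltn a'a.
  by rewrite /F !ffunE eqxx.
rewrite -mulr_sumr (_ : \sum_t F (K a + t) = \sum_t F t); last first.
  by rewrite [RHS](reindex_inj (addrI (K a))).
rewrite /F.
rewrite big_split /= sumr_const card_Fp// big_split /= sum_Fp_gt -mulr_suml.
rewrite (bigD1 (z a))//= eqxx big1 => [|t /negbTE ne]; last by rewrite eq_sym ne.
rewrite addr0 mul1r digit_tailS -mulr_natl.
by rewrite [X in _ * X = 0](_ : _ = 0) ?mulr0//; field.
Qed.

(* As a function of [z], [increment j z K] is affine in the digits of index at
   least [j]: see [increment_expand]. *)
Definition inc_slope j z K : R :=
  - (agree j z K)%:R + \sum_(a < n | a.+1 == j) (agree a z K)%:R / b%:R.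

(** The sum over [a.+1 == j] has the single term of digit [j - 1], or none if [j = 0], which covers
    level 0 by the same formula. *)
Definition inc_const j z K : R :=
  (agree j z K)%:R + inc_slope j z K * (eps%:R / b%:R ^+ (n - j))
  + \sum_(a < n | a.+1 == j) ((agree a z K && (z a < K a)%N)%:R
                          - (agree a z K)%:R * (1 - (z a : nat)%:R / b%:R)).

Lemma increment_expand j z K : (j <= n)%N -> increment j z K =
  inc_const j z K + \sum_(a < n | (j <= a)%N)
    b%:R ^- (a.+1 - j) * (inc_slope j z K * (z a : nat)%:R).
Proof.
move=> jn; pose S := digit_tail j z.
suff -> : increment j z K = (agree j z K)%:R + inc_slope j z K * S
  + \sum_(a < n | a.+1 == j) ((agree a z K && (z a < K a)%N)%:R
                          - (agree a z K)%:R * (1 - (z a : nat)%:R / b%:R)).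
  rewrite /inc_const /S /digit_tail mulrDr -!addrA; congr (_ + _).
  rewrite [LHS]addrC -[LHS]addrA; congr (_ + (_ + _)).
  by rewrite mulr_sumr; apply: eq_bigr => a _; rewrite [RHS]mulrC -mulrA.
rewrite /inc_slope /S; case: j jn {S} => [|j] jn.
  rewrite /increment /level !big_pred0//; by ring.
pose a := Ordinal jn; have aE a' : (a'.+1 == j.+1)%N = (a' == a).
  by rewrite eqSS -val_eqE.
rewrite (eq_bigl _ _ aE) big_pred1_eq (eq_bigl _ _ aE) big_pred1_eq.
rewrite (incrementS a) (digit_tailS a) [in agree j.+1 _ _](_ : j = a)// agreeS.
by rewrite -!mulnb !natrM; field.
Qed.

Lemma agree_pred j z K : agree j z K -> agree j.-1 z K.
Proof. exact/agree_le/leq_pred. Qed.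

Lemma inc_slope_bound j z K : (j <= n)%N ->
  `|inc_slope j z K| <= (agree j.-1 z K)%:R.
Proof.
have b1 : (0 <= b%:R^-1 :> R) && (b%:R^-1 <= 1 :> R) by rewrite invr_ge0 ler0n invf_le1 ?ler1n.
rewrite /inc_slope; case: j => [|j] jn.
  by rewrite big_pred0// addr0 normrN normr_nat.
pose a := Ordinal jn; have aE a' : (a'.+1 == j.+1)%N = (a' == a).
  by rewrite eqSS -val_eqE.
rewrite (eq_bigl _ _ aE) big_pred1_eq /= [in agree j.+1 _ _](_ : j = a)// agreeS /=.
move: b1 => /andP[b0 b1]; rewrite ler_norml.
by case: (agree j z K); case: (_ == _); rewrite /= ?mul1r ?mul0r; apply/andP; split; lra.
Qed.

Lemma inc_const_bound j z K : (j <= n)%N ->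
  `|inc_const j z K| <= 3 * (agree j.-1 z K)%:R.
Proof.
move=> jn; rewrite /inc_const; set e := (agree j.-1 z K)%:R.
have -> : 3 * e = e + e + e by ring.
rewrite (le_trans (ler_normD _ _))// lerD//.
  rewrite (le_trans (ler_normD _ _))// lerD//.
    by rewrite normr_nat ler_nat; case: agree (@agree_pred j z K) => // ->.
  rewrite normrM (le_trans _ (inc_slope_bound z K jn))// ler_piMr//.
  rewrite ger0_norm ?divr_ge0 ?exprn_ge0// ler_pdivrMr ?exprn_gt0// mul1r.
  by rewrite (le_trans (y := 1)) ?lern1 ?leq_b1// exprn_ege1// ler1n.
rewrite {}/e; case: j jn => [|j] jn; first by rewrite big_pred0// normr0.
pose a := Ordinal jn; have aE a' : (a'.+1 == j.+1)%N = (a' == a).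
  by rewrite eqSS -val_eqE.
rewrite (eq_bigl _ _ aE) big_pred1_eq /=.
have u0 : 0 <= (z a : nat)%:R / b%:R :> R by rewrite divr_ge0.
have u1 : (z a : nat)%:R / b%:R <= 1 :> R.
  by rewrite ler_pdivrMr// mul1r ler_nat ltnW// Fp_lt.
rewrite ler_norml.
case: (agree j z K); case: (_ < _)%N; rewrite /= ?mul1r ?mul0r; apply/andP; split; lra.
Qed.

Lemma inc_slope_digit_bound j z K a : (j <= n)%N ->
  `|inc_slope j z K * (z a : nat)%:R| <= b%:R * (agree j.-1 z K)%:R.
Proof.
move=> jn; rewrite normrM normr_nat mulrC ler_pM// ?inc_slope_bound//.
by rewrite ler_nat ltnW// Fp_lt.
Qed.

Lemma eq_inc_slope j z z' K : (forall a, (a < j)%N -> z a = z' a) ->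
  inc_slope j z K = inc_slope j z' K.
Proof.
move=> zz'; rewrite /inc_slope (eq_agree _ zz'); congr (_ + _).
apply: eq_bigr => a /eqP aj; rewrite (@eq_agree _ _ _ z z')// => a' a'a.
by rewrite zz'// -aj ltnW.
Qed.

Lemma eq_inc_const j z z' K : (forall a, (a < j)%N -> z a = z' a) ->
  inc_const j z K = inc_const j z' K.
Proof.
move=> zz'; rewrite /inc_const (eq_inc_slope _ zz') (eq_agree _ zz').
congr (_ + _); apply: eq_bigr => a /eqP aj.
rewrite (@eq_agree _ _ _ z z') ?zz' ?aj// -?aj// => a' a'a.
by rewrite zz'// -aj ltnW.
Qed.

End offset.
End increments.

(** * Integration errors of an order 2 digital net *)

(** Independent rows form a matrix with a right inverse, which is applied to the vector of
    prescribed values. *)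
Lemma free_map_solve (F : fieldType) (n : nat) (T : eqType) (P : seq T)
    (g : T -> 'rV[F]_n) (f : T -> F) :
  free [seq g p | p <- P] ->
  exists y : 'cV[F]_n, forall p, p \in P -> (g p *m y) ord0 ord0 = f p.
Proof.
move=> freeP'; pose m := size P; pose t := in_tuple P.
pose M := \matrix_(k < m) g (tnth t k).
have /row_freeP[B MB] : row_free M.
  apply: inj_row_free => u uM; apply/rowP => k; rewrite mxE.
  have /freeP/(_ (u ord0)) : free (map_tuple g t) by [].
  apply; rewrite -[RHS]uM mulmx_sum_row; apply: eq_bigr => i _.
  by rewrite rowK (nth_map (tnth t i)) ?size_tuple ?ltn_ord// -tnth_nth.
exists (B *m \col_k f (tnth t k)) => p /(tnthP t)[k ->].
have -> : g (tnth t k) = row k M by rewrite rowK.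
by rewrite -row_mul mulmxA MB mul1mx !mxE.
Qed.

Section nets.
Context {R : realFieldType} {b n d s v : nat} (b_pr : prime b).
Notation digit_row := {ffun 'I_n -> 'F_b}.
Notation Omega := {ffun 'I_d -> digit_row}.
Context (C : 'I_d -> 'M['F_b]_(s, n)) (n_le_s : (n <= s)%N).
Implicit Types (w K : Omega) (y : 'cV['F_b]_n) (i : 'I_d) (a : 'I_n).

Let bR_gt0 : 0 < b%:R :> R. Proof. by rewrite ltr0n prime_gt0. Qed.

Lemma card_Omega : #|{: Omega}| = (b ^ (n * d))%N.
Proof. by rewrite card_ffun card_digit_row// card_ord expnM. Qed.

Lemma card_Omega_gt0 : (0 < #|{: Omega}|)%N.
Proof. by rewrite card_Omega expn_gt0 prime_gt0. Qed.

Lemma card_cV_gt0 : (0 < #|{: 'cV['F_b]_n}|)%N.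
Proof. by rewrite card_mx expn_gt0 card_Fp// prime_gt0. Qed.

Lemma add_ffun2E w w' i a : (w + w') i a = w i a + w' i a.
Proof. by rewrite [in LHS]ffunE [LHS]ffunE. Qed.

(** The first [n] digits of each coordinate. Indexing by vectors [y] instead of integers makes the
    net additive in its index. *)
Definition net_point y : Omega :=
  [ffun i => [ffun a => (C i *m y) (widen_ord n_le_s a) ord0]].

Lemma net_pointD y y' : net_point (y + y') = net_point y + net_point y'.
Proof. by apply/ffunP => i; apply/ffunP => a; rewrite !ffunE mulmxDr mxE. Qed.

Definition net_error (g : Omega -> R) : R :=
  avg (fun y => g (net_point y)) - avg g.

Lemma eq_net_error g h : g =1 h -> net_error g = net_error h.
Proof.
by move=> gh; rewrite /net_error (eq_avg gh) (eq_avg (fun y => gh (net_point y))).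
Qed.

(* If the digits in [S] take all values on the net, then averaging over the net
   is invariant under translation by any [w], hence equals the full average. *)
Lemma net_error_eq0 (S : 'I_d -> pred 'I_n) (g : Omega -> R) :
  (forall w, exists y, forall i a, S i a -> net_point y i a = w i a) ->
  (forall w w', (forall i a, S i a -> w i a = w' i a) -> g w = g w') ->
  net_error g = 0.
Proof.
move=> surj gS; apply/eqP; rewrite subr_eq0; apply/eqP.
have E w : avg (fun y => g (net_point y)) = avg (fun y => g (net_point y + w)).
  have [y0 y0w] := surj w; rewrite -(avg_reindex _ (addIr y0)); apply: eq_avg => y.
  by apply: gS => i a Sia; rewrite net_pointD !add_ffun2E y0w.
rewrite -[LHS](avg_cst _ card_Omega_gt0) (eq_avg E) avg_exchange.
rewrite (eq_avg (g := fun=> avg g)) ?avg_cst ?card_cV_gt0// => y.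
exact: (avg_reindex _ (addrI (net_point y))).
Qed.
(** Strict decrease allows position [p] only once, and every other position is at most [j]. *)
Lemma sum_take2_le (q : seq 'I_s) (j p : nat) : (j <= p)%N ->
  sorted (fun l l' : 'I_s => (l' < l)%N) q ->
  {in q, forall l : 'I_s, (l < j)%N || (l.+1 == p)} ->
  (\sum_(l <- take 2 q) l.+1 <= j + p)%N.
Proof.
move=> jp; case: q => [|l [|l' q]] /=; rewrite ?big_nil//.
  by move=> _ /(_ l); rewrite big_seq1 inE eqxx => /(_ isT); lia.
rewrite take0 big_cons big_seq1 => /andP[l'l _] H.
have := H l; have := H l'; rewrite !inE !eqxx orbT => /(_ isT) + /(_ isT).
by lia.
Qed.

Lemma net_errorD g h : net_error (fun w => g w + h w) = net_error g + net_error h.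
Proof. by rewrite /net_error !avgD opprD addrACA. Qed.

Lemma net_error_lin (I : finType) (P : pred I) (c : I -> R) (g : I -> Omega -> R) :
  net_error (fun w => \sum_(x | P x) c x * g x w)
  = \sum_(x | P x) c x * net_error (g x).
Proof.
rewrite /net_error !avg_sum -sumrB; apply: eq_bigr => x _.
by rewrite !avgZ mulrBr.
Qed.

Definition prod_fun (u : 'I_d -> digit_row -> R) w : R := \prod_i u i (w i).

Lemma prod_funE u i w :
  prod_fun u w = u i (w i) * \prod_(k < d | k != i) u k (w k).
Proof. exact: bigD1. Qed.

Definition upd (T : Type) (f : 'I_d -> T) i (x : T) k := if k == i then x else f k.

Lemma eq_upd (T : Type) (f : 'I_d -> T) i x : upd f i x i = x.
Proof. by rewrite /upd eqxx. Qed.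

Lemma prod_fun_split u i h w : (forall k, k != i -> u k =1 h k) ->
  prod_fun h w = h i (w i) * \prod_(k < d | k != i) u k (w k).
Proof.
move=> uh; rewrite (prod_funE _ i); congr (_ * _); apply: eq_bigr => k ki.
by rewrite uh.
Qed.

(** * Exact integration and shares of boxes under order 2 *)

Section independent.
Hypothesis indep : order_independent 2 v C.

(* A strictly decreasing list of digits of index < j or = p-1 has its two largest
   positions summing to at most j + p, so order 2 makes these rows independent. *)
Lemma net_error_two_levels (j p : 'I_d -> nat) (g : Omega -> R) :
  (forall i, (j i <= p i <= n)%N) ->
  (\sum_i (j i + p i) <= 2 * n - v)%N ->
  (forall w w', (forall i a, (a < j i)%N || (a.+1 == p i) -> w i a = w' i a) ->
    g w = g w') ->
  net_error g = 0.
Proof.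
move=> jpn jpv; apply: net_error_eq0 => w.
pose S i (l : 'I_s) := (l < j i)%N || (l.+1 == p i).
pose lam i := [seq l <- rev (enum 'I_s) | S i l].
have lam_sorted i : sorted (fun l l' : 'I_s => (l' < l)%N) (lam i).
  apply: sorted_filter => [l1 l2 l3 /= + H|]; first exact: ltn_trans.
  rewrite rev_sorted; have := iota_ltn_sorted 0 s.
  by rewrite -val_enum_ord sorted_map.
have lam_S i : {in lam i, forall l, S i l}.
  by move=> l; rewrite mem_filter => /andP[].
have := indep lam_sorted; move/(_ _)/wrap => -[|].
  rewrite (leq_trans _ jpv)// leq_sum// => i _; apply: sum_take2_le => //.
  by case/andP: (jpn i).
rewrite (_ : [seq _ | i <- _, l <- _] =
  [seq row q.2 (C q.1) | q <- [seq (i, l) | i <- enum 'I_d, l <- lam i]]); last first.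
  by rewrite map_allpairs.
(* [f] prescribes the digits of [w] on the selected rows; the value 0 only makes it total, since
   [j i <= p i <= n] keeps the selected indices below [n]. *)
pose f (q : 'I_d * 'I_s) : 'F_b := if insub (q.2 : nat) is Some a then w q.1 a else 0.
move=> /(free_map_solve f)[y yf]; exists y => i a Sia; rewrite !ffunE.
have := yf (i, widen_ord n_le_s a); rewrite /f /= valK -row_mul mxE; apply.
apply/allpairsPdep; exists i, (widen_ord n_le_s a).
split; rewrite ?mem_enum// /lam mem_filter mem_rev mem_enum andbT.
exact: Sia.
Qed.

(** Positive entries are lowered by one until the sum is [m]; this serves to enlarge a box to a
    prescribed volume. *)
Lemma exists_le_sum_eq (j : 'I_d -> nat) m : (m <= \sum_i j i)%N ->
  exists2 j' : 'I_d -> nat, forall i, (j' i <= j i)%N & (\sum_i j' i = m)%N.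
Proof.
move=> mj; rewrite -(subKn mj).
elim: (_ - m)%N (leq_subr m (\sum_i j i)) => [|r IH] rj.
  by exists j => //; rewrite subn0.
have [j' j'j sj'] := IH (ltnW rj).
have [i i0] : exists i, (0 < j' i)%N.
  apply/existsP; apply: contraTT rj; rewrite negb_exists => /forallP j'0.
  move: sj'; rewrite big1 => [|i _]; last by have := j'0 i; rewrite lt0n negbK => /eqP.
  by lia.
exists (fun k => if k == i then (j' k).-1 else j' k) => [k|].
  by case: ifP => _ //; rewrite (leq_trans (leq_pred _)).
rewrite (bigD1 i)//= eqxx; move: sj'; rewrite (bigD1 i)//= => sj'.
rewrite (eq_bigr j') => [|k /negbTE ->//].
by move: sj' i0 rj; lia.
Qed.

(** Indicator of the b-adic box around [K] with side lengths [b ^- j i]. *)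
Definition box_share (j : 'I_d -> nat) K w : R := \prod_i (agree (j i) (w i) (K i))%:R.

Lemma box_share_bounds j K w : 0 <= box_share j K w <= 1.
Proof.
apply/andP; split; first exact: prodr_ge0.
by apply: prodr_ile1 => i _; rewrite ler0n lern1 leq_b1.
Qed.

Lemma avg_box_share j K : (forall i, (j i <= n)%N) ->
  avg (box_share j K) = b%:R ^- \sum_i j i.
Proof.
move=> jn; rewrite /box_share (avg_prod (fun i z => (agree (j i) z (K i))%:R)).
under eq_bigr do rewrite avg_agree//.
by rewrite prodfV expr_sum.
Qed.

Lemma avg_box_shareC j w : (forall i, (j i <= n)%N) ->
  avg (box_share j ^~ w) = b%:R ^- \sum_i j i.
Proof.
move=> jn; rewrite -(avg_box_share w jn); apply: eq_avg => K.
by apply: eq_bigr => i _; rewrite agreeC.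
Qed.

(** The box is enlarged until its levels sum to [minn (\sum_i j i) n - v]. The net integrates the
    indicator of that box exactly, by [net_error_two_levels] with [p = j'], so its share equals its
    volume. *)
Lemma box_share_net_le j K : (forall i, (j i <= n)%N) ->
  avg (fun y => box_share j K (net_point y))
    <= b%:R ^+ v / b%:R ^+ minn (\sum_i j i) n.
Proof.
move=> jn; set m := minn _ _.
have [j' j'j sj'] : exists2 j' : 'I_d -> nat, forall i, (j' i <= j i)%N
    & (\sum_i j' i = m - v)%N.
  by apply: exists_le_sum_eq; rewrite (leq_trans (leq_subr _ _))// geq_minl.
have j'n i : (j' i <= n)%N := leq_trans (j'j i) (jn i).
apply: (@le_trans _ _ (avg (fun y => box_share j' K (net_point y)))).
  apply: ler_avg => y; apply: ler_prod => i _; rewrite ler0n ler_nat.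
  by case: (agree (j i) _ _) (@agree_le _ _ _ _ (net_point y i) (K i) (j'j i)) => // ->.
have : net_error (box_share j' K) = 0.
  apply: (@net_error_two_levels j' j') => [i||w w' ww'].
  - by rewrite leqnn j'n.
  - rewrite big_split /= sj'; have : (m <= n)%N by rewrite geq_minr.
    by lia.
  - apply: eq_bigr => i _; rewrite (@eq_agree _ _ _ _ (w' i))// => a aj.
    by rewrite ww'// aj.
rewrite /net_error avg_box_share// => /eqP; rewrite subr_eq0 sj' => /eqP ->.
rewrite ler_pdivlMr ?exprn_gt0// mulrC ler_pdivrMr ?exprn_gt0// -exprD.
by rewrite ler_weXn2l ?ler1n ?prime_gt0//; lia.
Qed.

(** * Small levels: expansion in the remaining digits *)

Section expansion.
Context (eps : bool).

(** [o] selects a term of [increment_expand]: [None] the constant one, [Some a] that of digit [a],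
    stripped of its weight. The reach is the last digit position, counted from 1, on which the term
    may depend. *)
Definition reach (j : nat) (o : option 'I_n) : nat := if o is Some a then a.+1 else j.

Definition piece j o (z k : digit_row) : R :=
  if o is Some a then inc_slope j z k * (z a : nat)%:R else inc_const eps j z k.

Lemma piece_bound j o z k : (j <= n)%N ->
  `|piece j o z k| <= (b + 3)%:R * (agree j.-1 z k)%:R.
Proof.
move=> jn; rewrite natrD mulrDl; case: o => [a|] /=.
  by rewrite (le_trans (inc_slope_digit_bound _ _ _ _ _))// lerDl mulr_ge0.
by rewrite (le_trans (inc_const_bound _ _ _ _ _))// lerDr mulr_ge0.
Qed.

Lemma eq_piece j o (z z' k : digit_row) : (forall a, (a < j)%N || (a.+1 == reach j o) -> z a = z' a) ->
  piece j o z k = piece j o z' k.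
Proof.
move=> zz'; have zj a : (a < j)%N -> z a = z' a by move=> aj; rewrite zz'// aj.
case: o zz' => [a|] zz' /=; last exact: eq_inc_const.
by rewrite (eq_inc_slope _ zj) zz'// eqxx orbT.
Qed.

(* The factors of the coordinates in [l] are whole increments, the others are
   single terms of their expansions in the digits of the points. *)
Definition expansion (j : 'I_d -> nat) (o : 'I_d -> option 'I_n) (l : seq 'I_d) K i :
    digit_row -> R :=
  if i \in l then increment eps (j i) ^~ (K i) else piece (j i) (o i) ^~ (K i).

Lemma sum_pred_ge (j : 'I_d -> nat) : (\sum_i j i <= \sum_i (j i).-1 + d)%N.
Proof.
rewrite -[X in (_ + X)%N]card_ord -sum1_card -big_split /= leq_sum// => i _.
by rewrite addn1 leqSpred.
Qed.

(** The net average and the full average are bounded separately. Each factor is supported on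
    agreement of [(j i).-1] digits, and passing from [j] to these predecessors costs at most
    [b ^+ d]. *)
Lemma expansion_bound0 j o K : (forall i, (j i <= n)%N) -> (\sum_i j i <= n)%N ->
  `|net_error (prod_fun (expansion j o [::] K))|
  <= 2 * (b + 3)%:R ^+ d * b%:R ^+ (v + d) / b%:R ^+ (\sum_i j i).
Proof.
move=> jn sjn; pose A : R := (b + 3)%:R ^+ d; pose j1 i := (j i).-1.
have j1n i : (j1 i <= n)%N by rewrite (leq_trans (leq_pred _)).
have le_share w : `|prod_fun (expansion j o [::] K) w| <= A * box_share j1 K w.
  rewrite /A -[X in _ ^+ X](card_ord d) -prodr_const -big_split normr_prod /=.
  by apply: ler_prod => i _; rewrite normr_ge0 piece_bound.
pose B : R := b%:R ^+ (v + d) / b%:R ^+ \sum_i j i.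
have share_B : b%:R ^+ v / b%:R ^+ (\sum_i j1 i) <= B.
  rewrite ler_pdivrMr ?exprn_gt0// mulrAC ler_pdivlMr ?exprn_gt0// -!exprD.
  rewrite ler_weXn2l ?ler1n ?prime_gt0// -addnA leq_add2l.
  by rewrite addnC sum_pred_ge.
have -> : 2 * A * b%:R ^+ (v + d) / b%:R ^+ (\sum_i j i) = A * B + A * B.
  by rewrite /B; ring.
have A0 : 0 <= A by rewrite exprn_ge0.
rewrite (le_trans (ler_normB _ _))// lerD//.
  apply: le_trans (ler_norm_avg _) _.
  apply: le_trans (ler_avg (fun y => le_share (net_point y))) _.
  rewrite avgZ ler_wpM2l// (le_trans (box_share_net_le _ j1n))//.
  by rewrite (minn_idPl _)// (leq_trans _ sjn)// leq_sum// => i _; exact: leq_pred.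
apply: le_trans (ler_norm_avg _) _; apply: le_trans (ler_avg le_share) _.
rewrite avgZ ler_wpM2l// avg_box_share// (le_trans _ share_B)//.
by rewrite ler_peMl ?invr_ge0 ?exprn_ge0// exprn_ege1// ler1n prime_gt0.
Qed.

Lemma sum_geometric_le (x : R) (m J : nat) : 0 <= x -> (J <= m)%N ->
  (1 - x) * \sum_(a < m | (J <= a)%N) x ^+ (a.+1 - J) <= x.
Proof.
move=> x0 Jm; rewrite (_ : _ * _ = x - x ^+ (m.+1 - J)) ?gerBl ?exprn_ge0//.
move: Jm; rewrite leq_eqVlt => /orP[/eqP <-|].
  rewrite big_pred0 => [|a]; last by rewrite leqNgt ltn_ord.
  by rewrite mulr0 subSnn expr1 subrr.
elim: m => // m IH Jm; rewrite big_mkcond big_ord_recr -big_mkcond /= -ltnS Jm mulrDr.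
have [Jm'|] := boolP (J < m)%N.
  rewrite IH// [in RHS]subSn 1?ltnW// exprS.
  by ring.
rewrite -leqNgt => mJ; have -> : J = m by apply/eqP; rewrite eqn_leq mJ -ltnS Jm.
rewrite big_pred0 => [|a]; last by rewrite leqNgt ltn_ord.
by rewrite subSnn expr1 subSn// subSnn; ring.
Qed.

(* Any [beta < b] with [b < beta ^+ 2] would do: since the error vanishes unless
   [2 * n < total_reach j o [::]], it can be weighted by
   [beta ^+ (total_reach j o [::] - 2 * n)] and the sums over the reaches stay
   geometric. *)
Let beta : R := 3 / 4 * b%:R.

(** Coordinates in [l] count with [j i], the least reach among the terms of their expansion. *)
Definition total_reach (j : 'I_d -> nat) o (l : seq 'I_d) : nat :=
  (\sum_i (if i \in l then j i else reach (j i) (o i)) + \sum_i j i + v)%N.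

(** Induction on [l], expanding one whole increment at a time. The term of digit [a] has weight
    [b ^- (a.+1 - j i)] and raises the total reach by [a.+1 - j i], so its bound carries the factor
    [(3 / 4) ^+ (a.+1 - j i)]. *)
Lemma expansion_bound j o K l : uniq l ->
  (forall i, (j i <= n)%N) -> (\sum_i j i <= n)%N ->
  (forall i a, o i = Some a -> j i <= a)%N ->
  `|net_error (prod_fun (expansion j o l K))|
  <= 2 * (b + 3)%:R ^+ d * b%:R ^+ (v + d) / b%:R ^+ (\sum_i j i)
     * beta ^+ total_reach j o l / beta ^+ (2 * n) * 4 ^+ size l.
Proof.
move=> + jn sjn; have beta0 : 0 < beta by rewrite mulr_gt0// divr_gt0.
have beta1 : 1 <= beta.
  have : 2%:R <= b%:R :> R by rewrite ler_nat prime_gt1.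
  by rewrite /beta; lra.
pose M : R := 2 * (b + 3)%:R ^+ d * b%:R ^+ (v + d) / b%:R ^+ (\sum_i j i).
have M0 : 0 <= M by rewrite divr_ge0 ?mulr_ge0 ?exprn_ge0.
rewrite -[X in X * _ / _ * _]/M.
elim: l o => [|i l IH] o /= => [_ jo|/andP[il ul] jo]; set W := total_reach _ _ _.
  (* If [W <= 2 * n] the error is zero; otherwise [beta ^+ W / beta ^+ (2 * n)] is at least 1 and
     the trivial bound suffices. *)
  rewrite expr0 mulr1; have [small|large] := leqP W (2 * n).
    rewrite (@net_error_two_levels j (fun i => reach (j i) (o i))).
    - by rewrite normr0 divr_ge0 ?mulr_ge0 ?exprn_ge0// ltW.
    - move=> i; case: (o i) (jo i) => [a|] /= H; last by rewrite leqnn jn.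
      by rewrite ltn_ord ltnW// ltnS H.
    - rewrite big_split /=; move: small; rewrite /W /total_reach /=.
      by move: (\sum_i reach _ _)%N (\sum_i j i)%N => p q; lia.
    - move=> w w' ww'; apply: eq_bigr => i _; apply: eq_piece => a Ha.
      exact: ww'.
  apply: (le_trans (expansion_bound0 _ _ jn sjn)).
  rewrite -[leRHS]mulrA -/M ler_peMr//.
  by rewrite ler_pdivlMr ?exprn_gt0// mul1r ler_weXn2l// ltnW.
pose rest w := \prod_(k < d | k != i) expansion j o l K k (w k).
have prodE x w : prod_fun (expansion j (upd o i x) l K) w =
    piece (j i) x (w i) (K i) * rest w.
  rewrite (@prod_fun_split (expansion j o l K) i) => [|k ki z].
    by rewrite /expansion (negbTE il) eq_upd.
  by rewrite /expansion /upd (negbTE ki).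
have -> : net_error (prod_fun (expansion j o (i :: l) K)) =
    net_error (prod_fun (expansion j (upd o i None) l K)) +
    \sum_(a < n | (j i <= a)%N) b%:R ^- (a.+1 - j i) *
      net_error (prod_fun (expansion j (upd o i (Some a)) l K)).
  rewrite -net_error_lin -net_errorD; apply: eq_net_error => w.
  rewrite (@prod_fun_split (expansion j o l K) i) => [|k ki z]; last first.
    by rewrite /expansion inE (negbTE ki).
  rewrite {1}/expansion inE eqxx /= increment_expand// prodE mulrDl; congr (_ + _).
  by rewrite mulr_suml; apply: eq_bigr => a _; rewrite prodE mulrA.
have WE (x : option 'I_n) : (if x is Some a then j i <= a else true)%N ->
    `|net_error (prod_fun (expansion j (upd o i x) l K))| <=
    M * beta ^+ (W + (reach (j i) x - j i)) / beta ^+ (2 * n) * 4 ^+ size l.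
  move=> jx; have := IH (upd o i x) ul.
  have jx' k a : upd o i x k = Some a -> (j k <= a)%N.
    by rewrite /upd; case: eqP => [-> xa|_ /jo//]; move: jx; rewrite xa.
  move=> /(_ jx'); congr (_ <= M * beta ^+ _ / _ * _); rewrite /W /total_reach.
  rewrite (bigD1 i)//= (negbTE il) eq_upd [in RHS](bigD1 i)//= inE eqxx /=.
  rewrite (eq_bigr (fun k => if k \in i :: l then j k else reach (j k) (o k))).
    by case: x jx {jx'} => [a|] /=; lia.
  by move=> k /negbTE ki; rewrite inE ki /= /upd ki.
pose N := M * beta ^+ W / beta ^+ (2 * n) * 4 ^+ size l.
have N0 : 0 <= N by rewrite mulr_ge0 ?exprn_ge0// divr_ge0 ?mulr_ge0 ?exprn_ge0// ltW.
(* One [N] pays for the constant term, [3 * N] for the geometric series of ratio 3/4. *)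
have -> : M * beta ^+ W / beta ^+ (2 * n) * 4 ^+ (size l).+1 = N + 3 * N.
  by rewrite /N exprS; ring.
rewrite (le_trans (ler_normD _ _))// lerD//.
  by have := WE None isT; rewrite /= subnn addn0.
apply: le_trans (ler_norm_sum _ _ _) _.
apply: (@le_trans _ _ (\sum_(a < n | (j i <= a)%N) N * (3 / 4) ^+ (a.+1 - j i))).
  apply: ler_sum => a jia; rewrite normrM ger0_norm ?invr_ge0 ?exprn_ge0//.
  rewrite mulrC ler_pdivrMr ?exprn_gt0// (le_trans (WE (Some a) jia))//.
  rewrite -[leRHS]mulrA -[X in _ <= _ * X]exprMn -/beta /N exprD /=.
  by rewrite le_eqVlt; apply/orP; left; apply/eqP; ring.
rewrite -mulr_sumr mulrC ler_wpM2r//.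
have : 0 <= 3 / 4 :> R by rewrite divr_ge0.
by move=> /sum_geometric_le/(_ (jn i)); lra.
Qed.
End expansion.
(** * Moments of the components of the discrepancy *)

(* The coordinates in [l] are already summed over all their levels. *)
Definition coef_factor eps (j : 'I_d -> nat) (l : seq 'I_d) K i : digit_row -> R :=
  if i \in l then level eps n ^~ (K i) else increment eps (j i) ^~ (K i).

Definition coef eps j l K : R := net_error (prod_fun (coef_factor eps j l K)).

(** With whole increments everywhere, the total reach is twice the sum of the [j i] plus [v]. As
    [b >= 2], [beta ^- 2] is at most [8 / 9 / b], so each level missing to [n] gains a factor 8/9
    over [b ^- n]. *)
Lemma coef_small_bound eps j K : (forall i, (j i <= n)%N) -> (\sum_i j i <= n)%N ->
  `|coef eps j [::] K| <=
    (2 * (b + 3)%:R ^+ d * b%:R ^+ (v + d) * b%:R ^+ v * 4 ^+ d)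
    / b%:R ^+ n * (8 / 9) ^+ (n - \sum_i j i).
Proof.
move=> jn sjn.
have jo i a : (fun=> None : option 'I_n) i = Some a -> (j i <= a)%N by [].
have := expansion_bound eps K (enum_uniq 'I_d) jn sjn jo.
rewrite size_enum_ord (_ : total_reach _ _ _ = \sum_i j i + \sum_i j i + v)%N; last first.
  by rewrite /total_reach; congr (_ + _ + _)%N; apply: eq_bigr => i; rewrite mem_enum.
set J := (\sum_i j i)%N; set beta := 3 / 4 * _; set c := 2 * _ * _.
have -> : net_error (prod_fun (expansion eps j (fun=> None) (enum 'I_d) K)) = coef eps j [::] K.
  by apply: eq_net_error => w; apply: eq_bigr => i _; rewrite /expansion mem_enum.
have b2 : 2%:R <= b%:R :> R by rewrite ler_nat prime_gt1.
have beta0 : 0 < beta by rewrite /beta; lra.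
have c0 : 0 <= c by rewrite /c !mulr_ge0 ?exprn_ge0.
move=> H; apply: le_trans H _.
have [e nE] : exists e, n = (J + e)%N by exists (n - J)%N; rewrite subnKC.
have -> : (n - J = e)%N by rewrite nE addKn.
have -> : c * b%:R ^+ v * 4 ^+ d / b%:R ^+ n * (8 / 9) ^+ e =
  c / b%:R ^+ J * (b%:R ^+ v * (b%:R^-1 * (8 / 9)) ^+ e) * 4 ^+ d.
  have -> : b%:R ^+ n = b%:R ^+ J * b%:R ^+ e :> R by rewrite nE exprD.
  rewrite [(b%:R^-1 * _) ^+ e]exprMn exprVn invfM.
  by move: (_ ^+ J)^-1 (_ ^+ e)^-1 ((8 / 9) ^+ e) (4 ^+ d) => *; ring.
rewrite ler_wpM2r ?exprn_ge0// -[leLHS]mulrA ler_wpM2l ?divr_ge0 ?exprn_ge0//.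
have -> : beta ^+ (J + J + v) / beta ^+ (2 * n) = beta ^+ v * (beta^-1 ^+ 2) ^+ e.
  rewrite -exprM exprVn (_ : 2 * n = J + J + 2 * e)%N; last by rewrite nE; lia.
  by rewrite exprD [_ ^+ (_ + 2 * e)]exprD invfM mulrACA mulfV ?mul1r// expf_neq0// gt_eqF.
have binv : beta^-1 ^+ 2 <= b%:R^-1 * (8 / 9).
  rewrite exprVn -[X in X <= _]div1r ler_pdivrMr ?exprn_gt0//.
  rewrite [leRHS](_ : _ = b%:R / 2); last by rewrite /beta; field; rewrite gt_eqF.
  by lra.
have beta_ge0 := ltW beta0; have betab : beta <= b%:R by rewrite /beta; lra.
have x0 : 0 <= beta^-1 ^+ 2 by rewrite exprn_ge0// invr_ge0.
have y0 := le_trans x0 binv.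
by apply: ler_pM; rewrite ?(exprn_ge0 _ x0) ?(exprn_ge0 _ beta_ge0) ?lerXn2r ?nnegrE.
Qed.

Lemma coef_le_share eps j K : (forall i, (j i <= n)%N) ->
  `|coef eps j [::] K| <= 2 ^+ d *
    (avg (fun y => box_share (fun i => (j i).-1) K (net_point y))
      + b%:R ^- \sum_i (j i).-1).
Proof.
move=> jn; pose j1 i := (j i).-1.
have j1n i : (j1 i <= n)%N by rewrite (leq_trans (leq_pred _)).
have le_share w : `|prod_fun (fun i => increment eps (j i) ^~ (K i)) w|
    <= 2 ^+ d * box_share j1 K w.
  rewrite -[X in _ ^+ X](card_ord d) -prodr_const -big_split normr_prod /=.
  by apply: ler_prod => i _; rewrite normr_ge0 increment_bound.
rewrite -(avg_box_share K j1n) (le_trans (ler_normB _ _))// mulrDr -!avgZ lerD//.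
- apply: le_trans (ler_norm_avg _) _.
  exact: ler_avg (fun y => le_share (net_point y)).
- by apply: le_trans (ler_norm_avg _) _; exact: ler_avg le_share.
Qed.

(** The component is O(b^-n) pointwise, but its mean absolute value is O(b^-|j|): all powers but one
    are bounded pointwise and the last factor is averaged. *)
Lemma coef_large_moment eps j k : (forall i, (j i <= n)%N) -> (n <= \sum_i j i)%N ->
  avg (fun K => coef eps j [::] K ^+ k.+1.*2) <=
    (2 ^+ d.+1 * b%:R ^+ (v + d) / b%:R ^+ n) ^+ k.+1.*2 / b%:R ^+ (\sum_i j i - n).
Proof.
move=> jn nsj; pose j1 i := (j i).-1; set J := (\sum_i j i)%N in nsj *.
have j1n i : (j1 i <= n)%N by rewrite (leq_trans (leq_pred _)).
pose Q : R := b%:R ^+ (v + d) / b%:R ^+ n.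
have JJ1 : (J <= \sum_i j1 i + d)%N := sum_pred_ge j.
pose U : R := b%:R ^- \sum_i j1 i; pose share K := avg (fun y => box_share j1 K (net_point y)).
have UQ : U <= Q / b%:R ^+ (J - n).
  rewrite /U /Q -div1r ler_pdivrMr ?exprn_gt0// mulrAC ler_pdivlMr ?exprn_gt0//.
  rewrite mulrAC ler_pdivlMr ?exprn_gt0// mul1r -!exprD.
  by rewrite ler_weXn2l ?ler1n ?prime_gt0//; lia.
have Q0 : 0 <= Q by rewrite divr_ge0 ?exprn_ge0.
have UQ' : U <= Q.
  by rewrite (le_trans UQ)// ler_piMr// invf_le1 ?exprn_gt0// exprn_ege1// ler1n prime_gt0.
have shareQ K : share K <= Q.
  rewrite (le_trans (box_share_net_le K j1n))// /Q ler_pdivrMr ?exprn_gt0//.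
  rewrite mulrAC ler_pdivlMr ?exprn_gt0// -!exprD.
  by rewrite ler_weXn2l ?ler1n ?prime_gt0//; lia.
have share0 K : 0 <= share K.
  by apply: avg_ge0 => y; case/andP: (box_share_bounds j1 K (net_point y)).
(* Averages are exchanged: for a fixed point of the net, the share of the [K] whose box contains it
   is [U]. *)
have avg_share : avg share = U.
  rewrite avg_exchange (eq_avg (g := fun=> U)) ?avg_cst ?card_cV_gt0// => y.
  exact: avg_box_shareC.
pose T := 2 ^+ d.+1 * Q; have T0 : 0 <= T by rewrite mulr_ge0 ?exprn_ge0.
have -> : 2 ^+ d.+1 * b%:R ^+ (v + d) / b%:R ^+ n = T by rewrite /T /Q mulrA.
have fK K : coef eps j [::] K ^+ k.+1.*2 <= T ^+ k.*2.+1 * 2 ^+ d * (share K + U).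
  have := coef_le_share eps K jn; rewrite -/share -/U => fs.
  have XT : `|coef eps j [::] K| <= T.
    rewrite (le_trans fs)// /T exprSr -mulrA ler_wpM2l ?exprn_ge0//.
    by rewrite mulrDl mul1r lerD// shareQ.
  rewrite (le_trans (ler_norm _))// normrX doubleS exprSr -mulrA ler_pM ?exprn_ge0//.
  by rewrite lerXn2r ?nnegrE.
apply: le_trans (ler_avg fK) _; rewrite avgZ avgD avg_share avg_cst ?card_Omega_gt0//.
rewrite doubleS [T ^+ _.+2]exprSr -[leLHS]mulrA -[leRHS]mulrA ler_wpM2l ?exprn_ge0//.
rewrite /T exprSr -!mulrA ler_wpM2l ?exprn_ge0//.
by rewrite [b%:R ^+ _ * _]mulrA -/Q mulrDl mul1r lerD.
Qed.

Lemma bernoulli_le (x : R) m : 0 <= x <= 1 -> 1 - m%:R * x <= (1 - x) ^+ m.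
Proof.
move=> /andP[x0 x1]; elim: m => [|m IH]; first by rewrite mul0r subr0 expr0.
have y0 : 0 <= 1 - x by rewrite subr_ge0.
rewrite exprS (le_trans _ (ler_wpM2l y0 IH))// -natr1.
have : 0 <= m%:R * x * x by rewrite !mulr_ge0.
by set t := m%:R; nra.
Qed.

(* Chosen so that both [(8 / 9) ^+ 2 <= decay k] and [b%:R^-1 <= decay k ^+ k.+1]. *)
Definition decay k : R := 1 - (8 * k.+1)%:R^-1.

Lemma decay_bounds k : 7 / 8 <= decay k < 1.
Proof.
have : (8 * k.+1)%:R^-1 <= 8^-1 :> R.
  by rewrite lef_pV2 ?posrE ?ltr0n// ler_nat leq_pmulr.
have : 0 < (8 * k.+1)%:R^-1 :> R by rewrite invr_gt0 ltr0n.
by rewrite /decay; move: (_^-1) => t t0 t1; apply/andP; split; lra.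
Qed.

Lemma decay_exp k : b%:R^-1 <= decay k ^+ k.+1.
Proof.
have b2 : b%:R^-1 <= 2^-1 :> R by rewrite lef_pV2 ?posrE// ler_nat prime_gt1.
rewrite (le_trans b2)// /decay (le_trans _ (bernoulli_le _ _))//.
  rewrite natrM invfM mulrCA mulfV ?pnatr_eq0// mulr1; lra.
by rewrite invr_ge0 ler0n invf_le1 ?ler1n ?ltr0n.
Qed.

(** The distance between [x] and [n]: one of the truncated differences is zero. *)
Definition gap (x : nat) : nat := (x - n + (n - x))%N.

Definition coef_cst : R :=
  (2 * (b + 3)%:R ^+ d * b%:R ^+ (v + d) * b%:R ^+ v * 4 ^+ d
   + 2 ^+ d.+1 * b%:R ^+ (v + d)) ^+ 2.

Lemma sqr_div_mul (x y z : R) m e :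
  (x / y ^+ m * z ^+ e) ^+ 2 = x ^+ 2 / y ^+ (2 * m) * (z ^+ 2) ^+ e.
Proof. by rewrite -exprM !mul2n -!addnn !exprD invfM; ring. Qed.

Lemma coef_moment eps j k : (forall i, (j i <= n)%N) ->
  avg (fun K => coef eps j [::] K ^+ k.+1.*2) <=
    (coef_cst / b%:R ^+ (2 * n) * decay k ^+ gap (\sum_i j i)) ^+ k.+1.
Proof.
move=> jn; rewrite /coef_cst.
set A1 := _ * 4 ^+ d; set A2 := 2 ^+ d.+1 * _.
have A10 : 0 <= A1 by rewrite !mulr_ge0 ?exprn_ge0.
have A20 : 0 <= A2 by rewrite !mulr_ge0 ?exprn_ge0.
have /andP[r0 r1] := decay_bounds k.
have r_ge0 : 0 <= decay k by rewrite (le_trans _ r0).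
have Asq : A1 ^+ 2 <= (A1 + A2) ^+ 2.
  by rewrite lerXn2r ?nnegrE ?addr_ge0// lerDl.
have Asq' : A2 ^+ 2 <= (A1 + A2) ^+ 2.
  by rewrite lerXn2r ?nnegrE ?addr_ge0// lerDr.
have [sjn|/ltnW nsj] := leqP (\sum_i j i)%N n.
- have -> : gap (\sum_i j i) = (n - \sum_i j i)%N by rewrite /gap (eqP sjn).
  set e := (n - _)%N; set G := _ * decay k ^+ e.
  have fK K : coef eps j [::] K ^+ k.+1.*2 <= G ^+ k.+1.
    rewrite (le_trans (ler_norm _))// normrX exprn_double.
    have := coef_small_bound eps K jn sjn; rewrite -/A1 -/e => H.
    suff HG : `|coef eps j [::] K| ^+ 2 <= G.
      by rewrite lerXn2r ?nnegrE ?sqr_ge0// (le_trans _ HG)// sqr_ge0.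
    have A0 := le_trans (normr_ge0 _) H.
    apply: (@le_trans _ _ ((A1 / b%:R ^+ n * (8 / 9) ^+ e) ^+ 2)).
      by rewrite lerXn2r ?nnegrE.
    rewrite sqr_div_mul /G.
    apply: ler_pM; [by rewrite divr_ge0 ?sqr_ge0 ?exprn_ge0|by rewrite exprn_ge0 ?sqr_ge0| |].
      by rewrite ler_wpM2r ?invr_ge0 ?exprn_ge0// Asq.
    by rewrite lerXn2r ?nnegrE ?sqr_ge0//; lra.
  by apply: le_trans (ler_avg fK) _; rewrite avg_cst ?card_Omega_gt0.
have -> : gap (\sum_i j i) = (\sum_i j i - n)%N by rewrite /gap (eqP nsj) addn0.
set e := (_ - n)%N.
apply: le_trans (coef_large_moment eps k jn nsj) _; rewrite -/A2 -/e.
rewrite exprn_double [leRHS]exprMn -[decay k ^+ e ^+ _]exprM [(e * _)%N]mulnC [decay k ^+ _]exprM.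
have B0 : 0 <= (A2 / b%:R ^+ n) ^+ 2 := sqr_ge0 _.
apply: ler_pM; [by rewrite exprn_ge0|by rewrite invr_ge0 exprn_ge0| |].
- have BC : (A2 / b%:R ^+ n) ^+ 2 <= (A1 + A2) ^+ 2 / b%:R ^+ (2 * n).
    have := sqr_div_mul A2 b%:R 1 n 0; rewrite !expr0 !mulr1 => ->.
    by rewrite ler_wpM2r ?invr_ge0 ?exprn_ge0.
  by rewrite lerXn2r ?nnegrE// (le_trans B0).
- by rewrite -exprVn lerXn2r ?nnegrE ?invr_ge0 ?exprn_ge0// decay_exp.
Qed.

(** Two geometric sums meet at [a + c = n], so the invariant of the induction changes form there. It
    yields the bound 2, uniform in [m], [c] and [n]. *)
Lemma sum_gap_le (rho : R) (m c : nat) : 0 <= rho <= 1 ->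
  (1 - rho) * \sum_(a < m) rho ^+ gap (a + c) <=
    if (m + c <= n)%N then rho ^+ (n.+1 - (m + c)) else 2 - rho ^+ (m + c - n).
Proof.
move=> /andP[r0 r1]; elim: m => [|m IH].
  rewrite big_ord0 mulr0; case: ifP => _; first by rewrite exprn_ge0.
  rewrite subr_ge0 (le_trans (exprn_ile1 _ r0 r1))//; lra.
rewrite big_ord_recr /= mulrDr; set x := (m + c)%N in IH *.
rewrite addSn -/x; have [xn|nx|xn] := ltngtP x n; move: IH; rewrite /gap.
- rewrite (ltnW xn) => IH; rewrite (eqP (ltnW xn)) add0n subSS.
  rewrite (le_trans (lerD IH (lexx _)))// subSn ?(ltnW xn)// exprS; lra.
- rewrite leqNgt nx /= => IH; rewrite (eqP (ltnW nx)) addn0.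
  rewrite (le_trans (lerD IH (lexx _)))// subSn ?(ltnW nx)// exprS; lra.
- rewrite xn leqnn subnn addn0 subSnn expr1 expr0 => IH; lra.
Qed.

(** * Summation over the levels, one coordinate at a time *)

Definition unit_cell i (r : digit_row) : Omega := [ffun k => if k == i then r else 0].

Lemma add_unit_cellE K i r k : (K + unit_cell i r) k = if k == i then K k + r else K k.
Proof. by rewrite !ffunE; case: ifP; rewrite ?addr0. Qed.

Lemma coef_shift eps j l K i a t : i \notin l -> (j i <= a)%N ->
  coef eps j l (K + unit_cell i (unit_row a t)) = coef eps j l K.
Proof.
move=> il jia; apply: eq_net_error => w; apply: eq_bigr => k _.
rewrite /coef_factor add_unit_cellE; have [->|//] := eqVneq k i.
by rewrite (negbTE il) increment_shift.
Qed.

(** The martingale property of one factor passes to the component because [net_error] is linear. *)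
Lemma sum_coef_shift eps j l K i a : i \notin l -> j i = a.+1 ->
  \sum_t coef eps j l (K + unit_cell i (unit_row a t)) = 0.
Proof.
move=> il jia; pose rest w := \prod_(k < d | k != i) coef_factor eps j l K k (w k).
have E t : coef eps j l (K + unit_cell i (unit_row a t)) =
    net_error (fun w => increment eps a.+1 (w i) (K i + unit_row a t) * rest w).
  apply: eq_net_error => w; rewrite (@prod_fun_split (coef_factor eps j l K) i) => [|k ki z].
    by rewrite /coef_factor (negbTE il) jia add_unit_cellE eqxx.
  by rewrite /coef_factor add_unit_cellE (negbTE ki).
under eq_bigr do rewrite E -[net_error _]mul1r; rewrite -net_error_lin.
rewrite (@eq_net_error _ (fun=> 0)).
  by rewrite /net_error !avg_cst ?card_Omega_gt0 ?card_cV_gt0// subrr.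
move=> w; under eq_bigr do rewrite mul1r.
by rewrite -mulr_suml sum_increment_shift// mul0r.
Qed.

Lemma coef_cons eps j l K i : i \notin l ->
  coef eps j (i :: l) K = \sum_(a < n.+1) coef eps (upd j i (a : nat)) l K.
Proof.
move=> il; under eq_bigr do rewrite -[coef _ _ _ _]mul1r; rewrite -net_error_lin.
apply: eq_net_error => w; rewrite (@prod_fun_split (coef_factor eps j l K) i) => [|k ki z]; last first.
  by rewrite /coef_factor inE (negbTE ki).
rewrite /coef_factor inE eqxx /= -sum_increment mulr_suml; apply: eq_bigr => a _.
rewrite mul1r (@prod_fun_split (coef_factor eps j l K) i) => [|k ki z].
  by rewrite /coef_factor (negbTE il) eq_upd.
by rewrite /coef_factor /upd (negbTE ki).
Qed.

(** Translating digit [a] of coordinate [i] of [K] fixes the partial sum, which involves levels up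
    to [a] only, while the next component sums to zero over the translations. *)
Lemma coef_orthogonal eps j l i (a : 'I_n) (m : nat) : i \notin l ->
  \sum_K (\sum_(c < a.+1) coef eps (upd j i (c : nat)) l K) ^+ m
    * coef eps (upd j i a.+1) l K = 0.
Proof.
move=> il; pose y K := coef eps (upd j i a.+1) l K.
pose x K := (\sum_(c < a.+1) coef eps (upd j i (c : nat)) l K) ^+ m.
pose h t K := K + unit_cell i (unit_row a t).
have xh t K : x (h t K) = x K.
  congr (_ ^+ m); apply: eq_bigr => c _.
  by rewrite coef_shift// eq_upd -ltnS.
have E t : \sum_K x K * y K = \sum_K x K * y (h t K).
  rewrite (reindex_inj (addIr (unit_cell i (unit_row a t)))).
  by apply: eq_bigr => K _; rewrite xh.
have : \sum_(t : 'F_b) \sum_K x K * y K = 0.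
  under eq_bigr => t _ do rewrite (E t); rewrite exchange_big /= big1// => K _.
  by rewrite -mulr_sumr sum_coef_shift ?mulr0// eq_upd.
rewrite sumr_const card_Fp// => /eqP; rewrite mulrn_eq0.
by rewrite -[(b == 0)%N]negbK -lt0n prime_gt0//= => /eqP.
Qed.

Definition moment_cst k : R := 2 ^+ k.*2.+4.

Lemma coef_step eps j l i k (r : nat -> R) : i \notin l ->
  (forall x : nat, (x <= n)%N -> 0 < r x) ->
  (forall x : nat, (x <= n)%N ->
    avg (fun K => coef eps (upd j i x) l K ^+ k.+1.*2) <= r x ^+ k.+1) ->
  avg (fun K => coef eps j (i :: l) K ^+ k.+1.*2) <=
    (moment_cst k * \sum_(x < n.+1) r x) ^+ k.+1.
Proof.
move=> il r0 cr; under eq_avg do rewrite coef_cons//.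
rewrite /moment_cst.
apply: (avg_moment_sum (g := fun x : nat => coef eps (upd j i x) l)) => // x xn.
exact: (coef_orthogonal _ _ (Ordinal xn)).
Qed.

Lemma coef_cst_gt0 : 0 < coef_cst.
Proof.
rewrite /coef_cst exprn_gt0// ltr_wpDl ?mulr_ge0 ?exprn_ge0//.
by rewrite mulr_gt0 ?exprn_gt0.
Qed.

(** In one coordinate the decay in the gap is summed, giving [2 / (1 - decay k)]; each further
    coordinate contributes a factor [n.+1], its number of levels. Hence the exponent [d - 1] rather
    than [d]. *)
Lemma coef_cons_moment eps j l i k : uniq (i :: l) -> (forall i, (j i <= n)%N) ->
  avg (fun K => coef eps j (i :: l) K ^+ k.+1.*2) <=
    (moment_cst k ^+ (size l).+1 * (coef_cst / b%:R ^+ (2 * n))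
      * (2 / (1 - decay k)) * n.+1%:R ^+ size l) ^+ k.+1.
Proof.
have /andP[r0 r1] := decay_bounds k.
have rho0 : 0 < decay k by rewrite (lt_le_trans _ r0)// divr_gt0.
have rho1 : 0 < 1 - decay k by rewrite subr_gt0.
have B0 : 0 < coef_cst / b%:R ^+ (2 * n) := divr_gt0 coef_cst_gt0 (exprn_gt0 _ bR_gt0).
have m0 : 0 < moment_cst k by rewrite exprn_gt0.
have upd_le j' i' (a : nat) : (forall i, (j' i <= n)%N) -> (a <= n)%N ->
    forall i, (upd j' i' a i <= n)%N.
  by move=> jn an i0; rewrite /upd; case: ifP.
elim: l i j => [|i' l IH] i j /= ul jn.
  pose r (x : nat) := coef_cst / b%:R ^+ (2 * n) * decay k ^+ gap (\sum_k upd j i x k).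
  apply: (@le_trans _ _ ((moment_cst k * \sum_(x < n.+1) r x) ^+ k.+1)).
    apply: coef_step => // a an; first by rewrite mulr_gt0 ?exprn_gt0.
    exact/coef_moment/upd_le.
  have sum_r : \sum_(x < n.+1) r x <= coef_cst / b%:R ^+ (2 * n) * (2 / (1 - decay k)).
    rewrite -mulr_sumr ler_wpM2l ?(ltW B0)// ler_pdivlMr// mulrC.
    pose c := (\sum_(i' < d | i' != i) j i')%N.
    have rho01 : 0 <= decay k <= 1 by rewrite !ltW.
    under eq_bigr => a _.
      rewrite (bigD1 i)//= eq_upd (eq_bigr j) => [|i' /negbTE i'i]; last first.
        by rewrite /upd i'i.
      over.
    have := sum_gap_le n.+1 c rho01 => H; apply: le_trans H _.
    rewrite leqNgt addSn leq_addr /=; have := exprn_ge0 (n.+1 + c - n) (ltW rho0); lra.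
  rewrite expr0 expr1 mulr1 -[X in _ <= X ^+ _]mulrA.
  have sum_r_ge0 : 0 <= \sum_(x < n.+1) r x.
    by apply: sumr_ge0 => a _; rewrite mulr_ge0 ?exprn_ge0 ?ltW.
  have step : moment_cst k * \sum_(x < n.+1) r x <=
      moment_cst k * (coef_cst / b%:R ^+ (2 * n) * (2 / (1 - decay k))).
    by rewrite ler_wpM2l ?(ltW m0).
  have mr0 := mulr_ge0 (ltW m0) sum_r_ge0.
  by rewrite lerXn2r ?nnegrE// (le_trans mr0).
have /andP[il ul'] := ul; set S := _ * n.+1%:R ^+ size l in IH.
have S0 : 0 < S.
  have q0 : 0 < 2 / (1 - decay k) by rewrite divr_gt0.
  have n0 : 0 < n.+1%:R :> R by rewrite ltr0n.
  exact: (mulr_gt0 (mulr_gt0 (mulr_gt0 (exprn_gt0 _ m0) B0) q0) (exprn_gt0 _ n0)).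
have := @coef_step eps j (i' :: l) i k (fun=> S) il (fun _ _ => S0).
move=> /(_ (fun (x : nat) xn => IH i' _ ul' (upd_le _ _ _ jn xn))).
rewrite sumr_const card_ord -[S *+ _]mulr_natr; congr (_ <= _ ^+ _).
rewrite /S [moment_cst k ^+ (size l).+2]exprS [n.+1%:R ^+ (size l).+1]exprS.
by move: (n.+1%:R) => N; ring.
Qed.

(** The discrepancy of the truncated net at a corner of the cell [K]: the upper one for
    [eps = false], the lower one for [eps = true]. *)
Definition digit_discrepancy eps K : R :=
  avg (fun y => \prod_i
    (prefix_val n (net_point y i) < prefix_val n (K i) + ~~ eps)%N%:R)
  - \prod_i ((prefix_val n (K i) + ~~ eps)%:R / b%:R ^+ n).

Lemma digit_discrepancy_moment eps k : (0 < d)%N ->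
  avg (fun K => digit_discrepancy eps K ^+ k.+1.*2) <=
    (moment_cst k ^+ d * (coef_cst / b%:R ^+ (2 * n))
      * (2 / (1 - decay k)) * n.+1%:R ^+ d.-1) ^+ k.+1.
Proof.
move=> d0; have := size_enum_ord d; have := enum_uniq 'I_d.
case E : (enum 'I_d) => [|i l] ul sl; first by move: d0 sl => /= ? ?; lia.
have dl : size l = d.-1 := congr1 predn sl.
(* Every level gets summed over, so the initial levels may be taken as 0. *)
have := coef_cons_moment eps k ul (fun i => leq0n n).
rewrite dl prednK//; congr (_ <= _); apply: eq_avg => K; congr (_ ^+ _).
rewrite /coef -E (@eq_net_error _ (prod_fun (fun i => level eps n ^~ (K i)))).
  rewrite /net_error /prod_fun (avg_prod (fun i => level eps n ^~ (K i))).
  congr (_ - _); last by apply: eq_bigr => i' _; rewrite avg_leveln.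
  by apply: eq_avg => y; apply: eq_bigr => i' _; rewrite levelnE.
by move=> w; apply: eq_bigr => i' _; rewrite /coef_factor mem_enum.
Qed.

End independent.
End nets.

Local Open Scope classical_set_scope.
Local Open Scope ring_scope.

(** * From digits to the cube *)

(** The difference telescopes factor by factor; the bounds are carried through the same induction
    because its step uses them. *)
Lemma prod_diff_le (R : realFieldType) (I : finType) (x y : I -> R) :
  (forall i, 0 <= y i <= x i) -> (forall i, x i <= 1) ->
  [/\ 0 <= \prod_i y i <= \prod_i x i, \prod_i x i <= 1
    & \prod_i x i - \prod_i y i <= \sum_i (x i - y i)].
Proof.
move=> yx x1.
apply: (big_rec3 (fun X Y S => [/\ 0 <= Y <= X, X <= 1 & X - Y <= S])).
  by split; rewrite ?ler01 ?lexx ?subrr.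
move=> i X Y S _ [/andP[Y0 YX] X1 XY].
have /andP[y0 yxi] := yx i; have x1i := x1 i; have x0 := le_trans y0 yxi.
have X0 := le_trans Y0 YX; split.
- by rewrite mulr_ge0// ler_pM.
- by rewrite mulr_ile1.
- have : x i * (X - Y) <= 1 * (X - Y) by rewrite ler_wpM2r ?subr_ge0.
  have : (x i - y i) * Y <= (x i - y i) * 1.
    by rewrite ler_wpM2l ?subr_ge0// (le_trans YX).
  by rewrite mulrBr mulrBl; lra.
Qed.

Lemma sum_digits_modn (b k m : nat) : (0 < b)%N ->
  (\sum_(j < m) (k %/ b ^ j) %% b * b ^ j = k %% b ^ m)%N.
Proof.
move=> b0; elim: m => [|m IH]; first by rewrite big_ord0 modn1.
rewrite big_ord_recr /= IH [in RHS](divn_eq k (b ^ m)).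
rewrite {2}(divn_eq (k %/ b ^ m) b) mulnDl -mulnA -expnS -addnA modnMDl.
have := ltn_pmod (k %/ b ^ m) b0.
have : (k %% b ^ m < b ^ m)%N by rewrite ltn_pmod// expn_gt0 b0.
move: (k %% b ^ m)%N ((k %/ b ^ m) %% b)%N => r q rb qb.
by rewrite modn_small 1?addnC// expnS; nia.
Qed.

Lemma measurable_coord (R : realType) d (A : 'I_d -> set (measurableTypeR R)) :
  (forall i, measurable (A i)) ->
  measurable [set x : euclid R d | forall i, A i (tnth x i)].
Proof.
move=> mA.
rewrite (_ : [set x | _] = \bigcap_(i in [set: 'I_d]) (@tnth _ _ ^~ i @^-1` A i)).
  apply: fin_bigcap_measurable => // i _.
  by rewrite -[X in measurable X]setTI; exact: measurable_tnth.
by apply/seteqP; split => [x Ax i _|x Ax i]; exact: Ax.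
Qed.

(** * Cells of side b^-n and truncation of the net *)

Section net_geometry.
Context {R : realType} {b n d s : nat} (b_pr : prime b).
Context (C : 'I_d -> 'M['F_b]_(s, n)) (n_le_s : (n <= s)%N).
Notation digit_row := {ffun 'I_n -> 'F_b}.
Notation Omega := {ffun 'I_d -> digit_row}.
Implicit Types (K : Omega) (x : euclid R d).

Let b_gt0 : (0 < b)%N := prime_gt0 b_pr.
Let bR_gt0 : 0 < b%:R :> R. Proof. by rewrite ltr0n. Qed.

Lemma digits_inj : injective (fun nu : 'I_(b ^ n) => digits nu : 'cV['F_b]_n).
Proof.
move=> nu mu /matrixP E; apply: val_inj => /=.
rewrite -(modn_small (ltn_ord nu)) -(modn_small (ltn_ord mu)) -!sum_digits_modn//.
apply: eq_bigr => j _; congr (_ * _)%N.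
have := congr1 (fun t : 'F_b => t : nat) (E j ord0); rewrite !mxE !val_Fp_nat//.
by rewrite !modn_mod.
Qed.

Lemma avg_digits (f : 'cV['F_b]_n -> R) :
  (b ^ n)%:R^-1 * \sum_(nu < b ^ n) f (digits nu) = avg f.
Proof.
have card_cV : #|{: 'cV['F_b]_n}| = (b ^ n)%N by rewrite card_mx muln1 card_Fp.
rewrite /avg card_cV mulrC; congr (_ / _).
have [|g gK Kg] := inj_card_bij digits_inj; first by rewrite card_cV card_ord.
by rewrite [RHS](reindex (fun nu : 'I_(b ^ n) => digits nu))//; exists g => ? _.
Qed.

Lemma prefix_val_div (z : digit_row) :
  (prefix_val n z)%:R / b%:R ^+ n = \sum_(a < n) (z a : nat)%:R / b%:R ^+ a.+1 :> R.
Proof.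
rewrite /prefix_val (eq_bigl xpredT) => [|a]; last by rewrite ltn_ord.
rewrite natr_sum mulr_suml; apply: eq_bigr => a _.
rewrite natrM natrX -mulrA; congr (_ * _).
have -> : b%:R ^+ n = b%:R ^+ (n - a.+1) * b%:R ^+ a.+1 :> R by rewrite -exprD subnK.
by rewrite invfM mulrA mulfV ?mul1r// expf_neq0// gt_eqF.
Qed.

Lemma sum_top_digits m : (n <= m)%N ->
  \sum_(k < m | (n <= k)%N) (b%:R - 1) / b%:R ^+ k.+1 = b%:R ^- n - b%:R ^- m :> R.
Proof.
rewrite leq_eqVlt => /orP[/eqP <-|].
  by rewrite big_pred0 ?subrr// => k; rewrite leqNgt ltn_ord.
elim: m => // m IH nm; rewrite big_mkcond big_ord_recr -big_mkcond /= -ltnS nm.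
have -> : \sum_(k < m | (n <= k)%N) (b%:R - 1) / b%:R ^+ k.+1 = b%:R ^- n - b%:R ^- m :> R.
  move: nm; rewrite ltnS leq_eqVlt => /orP[/eqP <-|/IH//].
  by rewrite big_pred0 ?subrr// => k; rewrite leqNgt ltn_ord.
rewrite [b%:R ^+ m.+1]exprS invfM; have b0 : b%:R != 0 :> R by rewrite gt_eqF.
by rewrite mulrBl mul1r mulrA mulfV// mul1r addrA subrK.
Qed.

Definition truncate_digits (y : 'cV['F_b]_s) : digit_row :=
  [ffun a => y (widen_ord n_le_s a) ord0].

Lemma net_pointE y i : net_point C n_le_s y i = truncate_digits (C i *m y).
Proof. by rewrite ffunE. Qed.

(** The discarded digits are at most [b - 1], hence contribute less than [b ^- n]. *)
Lemma radix_value_itv (y : 'cV['F_b]_s) :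
  (prefix_val n (truncate_digits y))%:R / b%:R ^+ n <= (radix_value y : R)
    < (prefix_val n (truncate_digits y) + 1)%:R / b%:R ^+ n.
Proof.
rewrite natrD mulrDl mul1r prefix_val_div /radix_value.
have -> : \sum_(a < n) (truncate_digits y a : nat)%:R / b%:R ^+ a.+1 =
    \sum_(k < s | (k < n)%N) (y k ord0 : nat)%:R / b%:R ^+ k.+1 :> R.
  by rewrite (big_ord_narrow n_le_s); apply: eq_bigr => a _; rewrite ffunE.
rewrite [X in _ <= X < _](bigID (fun k : 'I_s => (k < n)%N)) /= lerDl ltrD2l sumr_ge0 /=; last first.
  by move=> k _; rewrite divr_ge0 ?exprn_ge0.
apply: (@le_lt_trans _ _ (b%:R ^- n - b%:R ^- s)); last first.
  by rewrite gtrBl invr_gt0 exprn_gt0.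
rewrite -sum_top_digits//; under eq_bigl do rewrite -leqNgt.
apply: ler_sum => k _; rewrite ler_wpM2r ?invr_ge0 ?exprn_ge0//.
by rewrite lerBrDr natr1 ler_nat Fp_lt.
Qed.

Definition cell K : set (euclid R d) :=
  [set x | forall i, (prefix_val n (K i))%:R / b%:R ^+ n <= (tnth x i : R)
                     < (prefix_val n (K i) + 1)%:R / b%:R ^+ n].

Lemma cell_cover x : unit_cube x -> exists K, cell K x.
Proof.
move=> x01; have [g gK Kg] := @val_ord_bij b n b_pr.
have bn0 : 0 < b%:R ^+ n :> R by rewrite exprn_gt0.
have tr_lt i : (Num.trunc (tnth x i * b%:R ^+ n) < b ^ n)%N.
  have := x01 i; rewrite in_itv /= => /andP[x0 x1].
  by rewrite truncn_lt_nat ?mulr_ge0 ?exprn_ge0// natrX gtr_pMl.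
exists [ffun i => g (Ordinal (tr_lt i))] => i; rewrite ffunE.
have -> : prefix_val n (g (Ordinal (tr_lt i))) = Num.trunc (tnth x i * b%:R ^+ n).
  by have /(congr1 val) := Kg (Ordinal (tr_lt i)).
have := x01 i; rewrite in_itv /= => /andP[x0 x1].
rewrite ler_pdivrMr// ltr_pdivlMr// addn1; apply: truncn_itv.
by rewrite mulr_ge0// ltW.
Qed.

Let lo K i : R := (prefix_val n (K i))%:R / b%:R ^+ n.
Let hi K i : R := (prefix_val n (K i) + 1)%:R / b%:R ^+ n.
Let side K i : set R := [set` `[lo K i, hi K i[].

Let measurable_side K i : measurable (side K i : set (measurableTypeR R)).
Proof. exact: measurable_itv. Qed.

Let cellE K : cell K = [set x | forall i, side K i (tnth x i)].
Proof.
by apply/seteqP; split => x Kx i; have := Kx i; rewrite /side /= in_itv.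
Qed.

Lemma measurable_cell K : measurable (cell K).
Proof. by rewrite cellE; apply: measurable_coord. Qed.

Lemma cell_measure K :
  lebesgue_tuple R d (cell K) = (#|{: Omega}|%:R^-1)%:E.
Proof.
have bn0 : 0 < b%:R ^- n :> R by rewrite invr_gt0 exprn_gt0.
rewrite cellE lebesgue_tuple_box; last exact: measurable_side.
rewrite (eq_bigr (fun=> (b%:R ^- n)%:E)) => [|i _].
  by rewrite prodEFin prodr_const card_ord card_Omega// natrX exprM exprVn.
rewrite /side lebesgue_measure_itv /= lte_fin /lo /hi natrD mulrDl mul1r ltrDl bn0.
by rewrite -EFinB addrC addKr.
Qed.

(** The share of points and the volume at [x] lie between those of the truncated net at the lower
    and the upper corner of the cell, and the two volumes differ by at most [d%:R / b%:R ^+ n]. *)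
Lemma discrepancy_cell_le K x : cell K x ->
  `|discrepancy (digital_net C) x| <=
    `|digit_discrepancy C n_le_s false K| + `|digit_discrepancy C n_le_s true K|
      + d%:R / b%:R ^+ n.
Proof.
move=> Kx; pose q i := prefix_val n (K i).
pose pt y : euclid R d := [tuple radix_value (C i *m y) | i < d].
pose net := avg (fun y => \1_(anchored_box x) (pt y) : R).
have -> : discrepancy (digital_net C) x = net - \prod_i tnth x i.
  by rewrite /discrepancy /net -avg_digits.
have qx i : (q i)%:R / b%:R ^+ n <= tnth x i < (q i + 1)%:R / b%:R ^+ n.
  exact: Kx.
pose count eps := avg (fun y => \prod_i
  (prefix_val n (net_point C n_le_s y i) < q i + ~~ eps)%N%:R : R).
have ptE y i : tnth (pt y) i = radix_value (C i *m y) by rewrite tnth_mktuple.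
have bn0 : 0 < b%:R ^+ n :> R by rewrite exprn_gt0.
have bn_ge0 := ltW bn0; have bnV : 0 <= b%:R ^- n :> R by rewrite invr_ge0.
have net_le : net <= count false.
  apply: ler_avg => y; rewrite indicE; case: (boolP (pt y \in _)) => [|_]; last exact: prodr_ge0.
  rewrite inE => boxy; rewrite big1// => i _; rewrite net_pointE /=.
  have /andP[ri _] := radix_value_itv (C i *m y); have /andP[_ xi] := qx i.
  have := boxy i; rewrite ptE in_itv /= => /andP[_ rx].
  have := le_lt_trans ri (lt_trans rx xi).
  by rewrite ltr_pM2r ?invr_gt0// ltr_nat => ->.
have net_ge : count true <= net.
  apply: ler_avg => y; rewrite indicE /=.
  have [/forallP Zq|] := boolP [forall i,
      (prefix_val n (net_point C n_le_s y i) < q i + 0)%N]; last first.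
    rewrite negb_forall => /existsP[i /negbTE Zi].
    by rewrite (bigD1 i)//= Zi mul0r.
  rewrite mem_set ?prodr_ile1// => i; first by rewrite ler0n lern1 leq_b1.
  rewrite ptE in_itv /=; have := Zq i; rewrite net_pointE addn0 -addn1 => Zi.
  have /andP[ri ri'] := radix_value_itv (C i *m y); have /andP[xi _] := qx i.
  apply/andP; split; first by rewrite (le_trans _ ri)// divr_ge0.
  rewrite (lt_le_trans ri')// (le_trans _ xi)//.
  by rewrite ler_wpM2r// ler_nat.
pose vol eps : R := \prod_i ((q i + ~~ eps)%:R / b%:R ^+ n).
have ddE eps : digit_discrepancy C n_le_s eps K = count eps - vol eps by [].
have x_lo : vol true <= \prod_i tnth x i.
  apply: ler_prod => i _; rewrite addn0; have /andP[-> _] := qx i.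
  by rewrite divr_ge0.
have x_hi : \prod_i tnth x i <= vol false.
  apply: ler_prod => i _; have /andP[xi /ltW ->] := qx i.
  by rewrite (le_trans _ xi)// divr_ge0.
have vol_diff : vol false - vol true <= d%:R / b%:R ^+ n.
  have [i|i|_ _ H] := @prod_diff_le R 'I_d (fun i => (q i + 1)%:R / b%:R ^+ n)
    (fun i => (q i + 0)%:R / b%:R ^+ n).
  - rewrite divr_ge0//= ler_wpM2r// ler_nat.
    by rewrite addn0 leq_addr.
  - rewrite ler_pdivrMr// mul1r -natrX ler_nat addn1.
    exact: prefix_val_lt.
  apply: (le_trans H); rewrite (eq_bigr (fun=> b%:R ^- n)) => [|i _].
    by rewrite sumr_const card_ord -[_ *+ _]mulr_natl.
  by rewrite -mulrBl addn0 natrD addrC addKr mul1r.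
rewrite !ddE; have := ler_norm (count false - vol false).
have := ler_norm (- (count true - vol true)); rewrite normrN => H1 H2.
have := normr_ge0 (count false - vol false); have := normr_ge0 (count true - vol true).
by move=> H3 H4; rewrite ler_norml; apply/andP; split; lra.
Qed.

End net_geometry.

(** * From moments over cells to the L_p norm *)

Lemma sum3_expr_le (R : realFieldType) (x y z : R) m : 0 <= x -> 0 <= y -> 0 <= z ->
  (x + y + z) ^+ m <= 3 ^+ m * (x ^+ m + y ^+ m + z ^+ m).
Proof.
move=> x0 y0 z0; have [M [M0 xyz HM]] : exists M, [/\ 0 <= M, x + y + z <= 3 * M
    & M ^+ m <= x ^+ m + y ^+ m + z ^+ m].
  have [xm ym zm] := And3 (exprn_ge0 m x0) (exprn_ge0 m y0) (exprn_ge0 m z0).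
  have [xy|/ltW yx] := leP x y; have [yz|/ltW zy] := leP y z; have [xz|/ltW zx] := leP x z;
    first [by exists x; split=> //; lra|by exists y; split=> //; lra|exists z; split=> //; lra].
rewrite (le_trans _ (ler_wpM2l (exprn_ge0 m (ler0n _ 3)) HM))// -exprMn.
by rewrite lerXn2r ?nnegrE ?addr_ge0// mulr_ge0.
Qed.

(** Passage from a real to an integer exponent: below [t] the first term suffices; above [t] the
    ratio [u / t] is at least 1, so its powers grow with the exponent. *)
Lemma powR_le_expr (R : realType) (u t p : R) m : 0 <= u -> 0 < t -> 0 <= p ->
  p <= m%:R -> u `^ p <= t `^ p * (1 + (u / t) ^+ m).
Proof.
move=> u0 t0 p0 pm; have t_ge0 := ltW t0; have ut0 := divr_ge0 u0 t_ge0.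
rewrite mulrDr mulr1; have tp0 := powR_ge0 t p.
have [ut|/ltW tu] := leP u t.
  rewrite (le_trans (ge0_ler_powR p0 _ _ ut)) ?nnegrE// lerDl.
  by rewrite mulr_ge0 ?exprn_ge0.
have -> : u `^ p = t `^ p * (u / t) `^ p by rewrite -powRM// mulrC divfK// gt_eqF.
apply: (@le_trans _ _ (t `^ p * (u / t) ^+ m)); last by rewrite lerDr.
rewrite ler_wpM2l// -powR_mulrn// ler_powR//.
by rewrite ler_pdivlMr// mul1r.
Qed.

Section cube_integral.
Context {R : realType} {d : nat}.

Lemma measurable_unit_cube : measurable (@unit_cube R d).
Proof.
apply: (@measurable_coord R d (fun=> `[0, 1[%classic)) => i.
exact: measurable_itv.
Qed.

Lemma measurable_discrepancy N (P : 'I_N -> euclid R d) :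
  measurable_fun [set: euclid R d] (discrepancy P).
Proof.
apply: measurable_funB; last first.
  by apply: measurable_prod => i _; exact: measurable_tnth.
apply: measurable_funM; first exact: measurable_cst.
apply: measurable_sum => k.
pose A i : set (measurableTypeR R) := [set t | tnth (P k) i \in `[0, t[ ].
rewrite (_ : (fun x => _) = \1_[set x : euclid R d | forall i, A i (tnth x i)]).
  apply: measurable_indic; apply: measurable_coord => i.
  have [P0|P0] := boolP (0 <= tnth (P k) i).
    rewrite (_ : A i = `]tnth (P k) i, +oo[%classic); first exact: measurable_itv.
    by apply/seteqP; split => t; rewrite /A /= !in_itv /= P0 andbT.
  rewrite (_ : A i = set0); first exact: measurable0.
  by apply/seteqP; split => t //; rewrite /A /= in_itv /= (negbTE P0).
by apply/funext => x; rewrite !indicE; congr (_%:R); apply/idP/idP => /set_mem ?;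
  apply/mem_set.
Qed.

(** On the cube, [f] is dominated by the step function with value [c K] on the cell [K], and all
    cells have the same measure. *)
Lemma cube_integral_le b n (b_pr : prime b) (f : euclid R d -> R)
    (c : {ffun 'I_d -> {ffun 'I_n -> 'F_b}} -> R) :
  measurable_fun [set: euclid R d] f -> (forall x, 0 <= f x) -> (forall K, 0 <= c K) ->
  (forall K x, cell K x -> f x <= c K) ->
  (\int[lebesgue_tuple R d]_(x in unit_cube) (f x)%:E <= (avg c)%:E)%E.
Proof.
move=> mf f0 c0 fc; have mI := measurable_unit_cube.
pose g K (x : euclid R d) : R := c K * \1_(cell K) x.
have g0 K x : 0 <= g K x by rewrite mulr_ge0.
have mg K : measurable_fun (@unit_cube R d) (EFin \o g K).
  apply/measurable_EFinP; apply: measurable_funM; first exact: measurable_cst.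
  by apply: measurable_indic; exact: measurable_cell.
apply: (@le_trans _ _ (\int[lebesgue_tuple R d]_(x in unit_cube) (\sum_K (g K x)%:E)))%E.
  apply: ge0_le_integral => //.
  - by move=> x _; rewrite lee_fin.
  - by apply/measurable_EFinP; exact: measurable_funTS.
  - exact: emeasurable_sum.
  - move=> x /(cell_cover b_pr (n := n))[K Kx]; rewrite sumEFin lee_fin.
    rewrite (bigD1 K)//= {1}/g indicE mem_set// mulr1.
    by rewrite (le_trans (fc K x Kx))// lerDl sumr_ge0.
rewrite (ge0_integral_sum _ mI mg); last by move=> K x _; rewrite lee_fin.
rewrite /avg mulr_suml -sumEFin; apply: lee_sum => K _.
rewrite /g; under eq_integral do rewrite /= EFinM.
rewrite ge0_integralZl_EFin//; last first.
  by apply/measurable_EFinP; apply: measurable_indic; exact: measurable_cell.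
rewrite integral_indic//; last exact: measurable_cell.
rewrite EFinM lee_wpmul2l ?lee_fin// -(cell_measure b_pr K).
apply: le_measure; rewrite ?inE; [|exact: measurable_cell|exact: subIsetl].
by apply: measurableI => //; exact: measurable_cell.
Qed.

End cube_integral.

Lemma Lp_cube_le (R : realType) (d b n k : nat) (p t : R) (b_pr : prime b)
    (f : euclid R d -> R) (g1 g2 : {ffun 'I_d -> {ffun 'I_n -> 'F_b}} -> R) (e : R) :
  1 <= p -> p <= k.+1.*2%:R -> 0 < t -> 0 <= e ->
  measurable_fun [set: euclid R d] f ->
  (forall K x, cell K x -> `|f x| <= `|g1 K| + `|g2 K| + e) ->
  avg (fun K => g1 K ^+ k.+1.*2) <= (t / 3) ^+ k.+1.*2 ->
  avg (fun K => g2 K ^+ k.+1.*2) <= (t / 3) ^+ k.+1.*2 ->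
  e <= t / 3 ->
  (Lp_cube p f <= (4 * t)%:E)%E.
Proof.
move=> p1 pm t0 e0 mf fg g1t g2t et; set m := k.+1.*2 in pm g1t g2t *.
have p0 : 0 < p := lt_le_trans ltr01 p1; have p_ge0 := ltW p0.
have t_ge0 := ltW t0; have t3_ge0 : 0 <= t / 3 by rewrite divr_ge0.
have even_norm (u : R) : `|u| ^+ m = u ^+ m.
  by rewrite /m !exprn_double real_normK// num_real.
(* Majorant of the p-th power of |f| on the cell [K]. Measuring in units of [t / 3] absorbs the
   [3 ^+ m] of [sum3_expr_le], so each of the three terms averages to at most 1. *)
pose c K := t `^ p * (1 + (t / 3) ^- m * (g1 K ^+ m + g2 K ^+ m + e ^+ m)).
have tp0 : 0 <= t `^ p := powR_ge0 _ _.
have c_ge K (u : R) : 0 <= u -> u <= `|g1 K| + `|g2 K| + e -> u `^ p <= c K.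
  move=> u0 uK; rewrite (le_trans (powR_le_expr u0 t0 p_ge0 pm))// ler_wpM2l// lerD2l.
  have := lerXn2r m u0 _ uK; rewrite nnegrE => /(_ (addr_ge0 (addr_ge0 (normr_ge0 _) (normr_ge0 _)) e0)).
  move=> um; have := le_trans um (sum3_expr_le m (normr_ge0 (g1 K)) (normr_ge0 (g2 K)) e0).
  rewrite !even_norm => {}um; rewrite expr_div_n ler_pdivrMr ?exprn_gt0//.
  apply: (le_trans um); rewrite expr_div_n invf_div le_eqVlt; apply/orP; left.
  by apply/eqP; field; rewrite expf_neq0// gt_eqF.
have c0 K : 0 <= c K by rewrite (le_trans _ (c_ge K 0 _ _)) ?powR_ge0// !addr_ge0.
have avg_c : avg c <= 4 * t `^ p.
  rewrite /c avgZ avgD avgZ !avgD !avg_cst ?card_Omega_gt0// mulrC ler_wpM2r//.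
  have em : e ^+ m <= (t / 3) ^+ m by rewrite lerXn2r.
  have t3m : 0 < (t / 3) ^+ m by rewrite exprn_gt0// divr_gt0.
  rewrite (_ : 4 = 1 + 3 :> R); last by ring.
  rewrite lerD2l mulrC ler_pdivrMr//.
  rewrite (_ : 3 * (t / 3) ^+ m = (t / 3) ^+ m + (t / 3) ^+ m + (t / 3) ^+ m); last by ring.
  by rewrite !lerD.
have int_le : (\int[lebesgue_tuple R d]_(x in unit_cube) (`|f x| `^ p)%:E <= (4 * t `^ p)%:E)%E.
  apply: le_trans (cube_integral_le (c := c) b_pr _ _ c0 _) _.
  - by apply: (measurableT_comp (measurable_powR p)); exact: measurableT_comp.
  - by move=> x; exact: powR_ge0.
  - by move=> K x Kx; rewrite c_ge// fg.
  - by rewrite lee_fin.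
rewrite Lp_cubeE ?gt_eqF//.
have int0 : (0 <= \int[lebesgue_tuple R d]_(x in unit_cube) (`|f x| `^ p)%:E)%E.
  by apply: integral_ge0 => x _; rewrite lee_fin powR_ge0.
have bnd0 : (0 <= (4 * t `^ p)%:E :> \bar R)%E by rewrite lee_fin mulr_ge0.
apply: le_trans (gt0_ler_poweR _ _ _ int_le) _.
- by rewrite invr_ge0.
- by rewrite in_itv /= int0 leey.
- by rewrite in_itv /= bnd0 leey.
rewrite poweR_EFin lee_fin.
have : 4 * t `^ p <= (4 * t) `^ p.
  rewrite powRM// ler_wpM2r// -{1}[4]powRr1// ler_powR//; lra.
move=> /(ge0_ler_powR (r := p^-1)) H; apply: (le_trans (H _ _ _)).
- by rewrite invr_ge0.
- by rewrite nnegrE mulr_ge0.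
- by rewrite nnegrE powR_ge0.
by rewrite -powRrM mulfV ?gt_eqF// powRr1// mulr_ge0.
Qed.

(** * The L_p discrepancy bound for order 2 digital nets *)

Unset Implicit Arguments.

Theorem corollary1p8 (R : realType) (d b v : nat) (p : R)
    (hd : (1 <= d)%N) (hb : prime b) (hp : 1 <= p) :
  exists C : R, 0 < C /\
    forall (n : nat) (P : 'I_(b ^ n) -> euclid R d),
      (0 < n)%N -> order_digital_net 2 v P ->
      (Lp_cube p (discrepancy P)
         <= (C * (n%:R `^ ((d%:R - 1) / 2) / b%:R ^+ n))%:E)%E.
Proof.
(* [k.+1.*2] is an even integer at least [p], so moments of that order control the L_p norm. *)
pose k := Num.trunc p.
have pk : p <= k.+1.*2%:R.
  have /andP[_ /ltW pk] := truncn_itv (le_trans ler01 hp).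
  by rewrite (le_trans pk)// ler_nat -addnn leq_addr.
have bR0 : 0 < b%:R :> R by rewrite ltr0n prime_gt0.
have decay1 : 0 < 1 - decay k :> R.
  by have /andP[_ ?] := @decay_bounds R k; rewrite subr_gt0.
pose q : R := 2 / (1 - decay k).
have q0 : 0 <= q by rewrite divr_ge0// ltW.
have kd0 : 0 <= moment_cst k ^+ d :> R by rewrite !exprn_ge0.
have cc0 : 0 <= coef_cst :> R := ltW (@coef_cst_gt0 R b d v hb).
(* The constant of the moment bound for the square; [2 ^+ d.-1] pays for replacing [n.+1] by [n]. *)
pose D : R := moment_cst k ^+ d * @coef_cst R b d v * q * 2 ^+ d.-1.
have D0 : 0 <= D := mulr_ge0 (mulr_ge0 (mulr_ge0 kd0 cc0) q0) (exprn_ge0 _ (ler0n _ 2)).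
(* The summand 1 gives [A <= A ^+ 2], [D] covers the moments and [d%:R] the error of passing to
   cells. *)
pose A : R := 1 + D + d%:R.
have A1 : 1 <= A by rewrite /A -addrA lerDl addr_ge0.
have A0 : 0 < A := lt_le_trans ltr01 A1.
(* The 3 makes each of the three terms at most [t / 3]; the 4 comes from [Lp_cube_le]. *)
exists (4 * (3 * A)); split; first by rewrite !mulr_gt0.
move=> n P n0 [s [C [_ sn2 _ indep ->]]].
have n_le_s : (n <= s)%N by rewrite (leq_trans _ sn2)// mul2n -addnn leq_addr.
pose w : R := n%:R `^ ((d%:R - 1) / 2).
have n1 : 1 <= n%:R :> R by rewrite ler1n.
have d1 : d%:R - 1 = d.-1%:R :> R by rewrite -{1}(prednK hd) -natr1 addrK.
have w2 : w ^+ 2 = n%:R ^+ d.-1.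
  by rewrite -powR_mulrn ?powR_ge0// /w -powRrM divfK// d1 powR_mulrn.
have w1 : 1 <= w by rewrite -(powRr0 n%:R) ler_powR// d1 divr_ge0.
have w0 : 0 < w := lt_le_trans ltr01 w1.
have bn0 : 0 < b%:R ^+ n :> R by rewrite exprn_gt0.
pose t : R := 3 * A * (w / b%:R ^+ n).
have t0 : 0 < t by rewrite !mulr_gt0// ?invr_gt0.
have t3 : t / 3 = A * w / b%:R ^+ n by rewrite /t; field; rewrite gt_eqF.
rewrite -!mulrA (mulrA 3 A) -/w -/t.
have moment eps : avg (fun K => digit_discrepancy C n_le_s eps K ^+ k.+1.*2) <=
    (t / 3 : R) ^+ k.+1.*2.
  apply: le_trans (digit_discrepancy_moment hb n_le_s indep eps k hd) _.
  rewrite exprn_double t3.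
  rewrite -/q; pose B : R := b%:R ^+ (2 * n).
  have B0 : 0 < B by rewrite exprn_gt0.
  have BV0 : 0 <= B^-1 by rewrite invr_ge0 ltW.
  have X0 : 0 <= moment_cst k ^+ d * (@coef_cst R b d v / B) * q * n.+1%:R ^+ d.-1 :=
    mulr_ge0 (mulr_ge0 (mulr_ge0 kd0 (mulr_ge0 cc0 BV0)) q0) (exprn_ge0 _ (ler0n _ _)).
  have XD : moment_cst k ^+ d * (@coef_cst R b d v / B) * q * n.+1%:R ^+ d.-1 <=
      (A * w / b%:R ^+ n) ^+ 2.
    have nn : n.+1%:R ^+ d.-1 <= 2 ^+ d.-1 * n%:R ^+ d.-1 :> R.
      have n2 : n.+1%:R <= 2 * n%:R :> R by rewrite -natr1 mulrDl mul1r lerD2l.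
      have n20 := le_trans (ler0n R n.+1) n2.
      by rewrite -exprMn lerXn2r// nnegrE.
    have -> : (A * w / b%:R ^+ n) ^+ 2 = A ^+ 2 * n%:R ^+ d.-1 / B.
      by rewrite !exprMn w2 exprVn -exprM mulnC.
    apply: (@le_trans _ _ (D * n%:R ^+ d.-1 / B)).
      have -> : D * n%:R ^+ d.-1 / B = moment_cst k ^+ d * (@coef_cst R b d v / B) * q
          * (2 ^+ d.-1 * n%:R ^+ d.-1) by rewrite /D; ring.
      by rewrite ler_wpM2l// mulr_ge0// mulr_ge0// mulr_ge0.
    rewrite ler_wpM2r// ler_wpM2r ?exprn_ge0//.
    have DA : D <= A by rewrite /A addrAC lerDr addr_ge0.
    by rewrite (le_trans DA)// ler_eXnr.
  by rewrite lerXn2r ?nnegrE ?(le_trans X0).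
apply: (@Lp_cube_le _ _ b n k p t hb _ (digit_discrepancy C n_le_s false)
  (digit_discrepancy C n_le_s true) (d%:R / b%:R ^+ n)) => //.
- exact: measurable_discrepancy.
- by move=> K x; exact: discrepancy_cell_le.
- rewrite t3 ler_wpM2r ?invr_ge0 ?(ltW bn0)//.
  by rewrite (le_trans (y := A)) ?ler_peMr ?(ltW A0)// /A lerDr addr_ge0.
Qed.
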